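(* There is an absolute constant $C > 0$ such that the following holds. Let $n \geq 1$, let $\mathcal H$ be a complex Hilbert space, $|\psi\rangle \in \mathcal H$ a state, and $(X_1, Z_1), \ldots, (X_n, Z_n)$ qubits in $\mathcal H$. Let $\epsilon \geq 0$ and assume that the $n$-qubit testing protocol (defined in the context), run on $|\psi\rangle$ with these qubits, accepts with probability at least $1 - \epsilon$. Let $|\mathrm{EPR}\rangle = \frac{1}{\sqrt 2}(|00\rangle + |11\rangle)$, let $\mathcal H' = \mathcal H \otimes (\mathbb{C}^2)^{\otimes 2n} = \mathcal H \otimes \bigotimes_{j=1}^n (\mathbb{C}^2_{j'} \otimes \mathbb{C}^2_{j''})$, and let $|\Psi_0\rangle = |\psi\rangle \otimes |\mathrm{EPR}\rangle^{\otimes n} \in \mathcal H'$, where the $j$th EPR state is on the registers $j', j''$. Let $|\Psi\rangle = \mathcal S_n \cdots \mathcal S_2 \mathcal S_1 |\Psi_0\rangle$, where $\mathcal S_j$ swaps the qubit $(X_j, Z_j)$ with register $j'$ (see context). Then there exist $n$ independent qubits $(\hat X_1, \hat Z_1), \ldots, (\hat X_n, \hat Z_n)$ in $\mathcal H'$ such that for every $k \geq 1$, every $j_1, \ldots, j_k \in \{1,\ldots,n\}$, and every sequence of operators $U_{j_1}, \ldots, U_{j_k}$, where each $U_{j_\ell}$ acts on the qubit $(X_{j_\ell}, Z_{j_\ell})$ and $\|U_{j_\ell}\| \leq 1$, $$\big\| U_{j_1} \cdots U_{j_k} |\Psi\rangle - \hat U_{j_1} \cdots \hat U_{j_k} |\Psi\rangle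 \big\| \leq C\, k\, n \sqrt{\epsilon} .$$ Here $\hat U_j$ is the same operator as $U_j$ but acting on the qubit $(\hat X_j, \hat Z_j)$: if $U_j = \alpha \mathbf 1 + \beta X_j + \gamma Z_j + \delta (i X_j Z_j)$ with scalars $\alpha, \beta, \gamma, \delta \in \mathbb{C}$, then $\hat U_j = \alpha \mathbf 1 + \beta \hat X_j + \gamma \hat Z_j + \delta (i \hat X_j \hat Z_j)$. (Operators on $\mathcal H$ are extended by the identity to $\mathcal H'$. Operators at different positions of the sequence may be different even if their indices coincide.)
   Context: A reflection is a Hermitian operator that squares to the identity. A qubit in a Hilbert space is a pair $(X,Z)$ of anti-commuting reflections ($XZ + ZX = 0$). Qubits $(\hat X_1,\hat Z_1),\ldots,(\hat X_n,\hat Z_n)$ are independent if $[\hat S_i, \hat T_j] = 0$ for all $i \neq j$ and $S,T \in \{X,Z\}$. An operator acts on the qubit $(X_j, Z_j)$ if it has the form $\alpha \mathbf 1 + \beta X_j + \gamma Z_j + \delta (i X_j Z_j)$ with complex scalars $\alpha,\beta,\gamma,\delta$. A state is a unit vector; $\|\cdot\|$ is the operator norm or vector norm. Measuring a reflection $R$ on a state $|\phi\rangle$ gives outcome $\pm 1$ with probability $\|\frac12(\mathbf 1 \pm R)|\phi\rangle\|^2$, leaving the normalized state proportional to $\frac12(\mathbf 1 \pm R)|\phi\rangle$. The $n$-qubit testing protocol, for a state $|\psi\rangle \in \mathcal H$ and qubits $(X_1,Z_1),\ldots,(X_n,Z_n)$ in $\mathcal H$: (1) Starting from $|\psi\rangle$,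 with equal probabilities $1/2$, measure all the reflections successively, either in the order $X_1, Z_1, X_2, Z_2, \ldots, X_n, Z_n$, or in the order $Z_1, X_1, Z_2, X_2, \ldots, Z_n, X_n$. (2) Pick a uniformly random index $j \in \{1,\ldots,n\}$. If the first order was used in step (1), measure $Z_j$; if the second order was used, measure $X_j$. Accept if the result equals the result of that same operator's measurement in step (1); otherwise reject. The swap operators on $\mathcal H'$ are $\mathcal S_j = \frac12\big(\mathbf 1 + X_j \otimes \sigma^x_{j'} + Z_j \otimes \sigma^z_{j'} + i (X_j Z_j) \otimes \sigma^y_{j'}\big)$, where $\sigma^x_{j'}, \sigma^y_{j'}, \sigma^z_{j'}$ are the standard Pauli matrices $\sigma^x = \begin{pmatrix}0&1\\1&0\end{pmatrix}$, $\sigma^y = \begin{pmatrix}0&-i\\i&0\end{pmatrix}$, $\sigma^z = \begin{pmatrix}1&0\\0&-1\end{pmatrix}$ acting on register $\mathbb{C}^2_{j'}$, with identity on all other ancilla registers. *)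

(* Defs.v *)
From HB Require Import structures.
From mathcomp Require Import all_boot all_order all_algebra.
From mathcomp Require Import complex.
From mathcomp Require Import boolp classical_sets reals ereal topology normedtype.

Set Implicit Arguments.
Unset Strict Implicit.
Unset Printing Implicit Defensive.

Import Order.TTheory GRing.Theory Num.Theory Num.Def.
Import numFieldNormedType.Exports.

Local Open Scope ring_scope.
Local Open Scope complex_scope.

Section InnerProduct.
Variables (R : realType) (V : lmodType R[i]) (dot : {dot V for @conjC R[i]}).

Definition hnorm (x : V) : R := Num.sqrt (complex.Re (dot x x)).

(* Extended-real valued, hence [+oo] on unbounded maps. *)
Definition opnorm (A : V -> V) : \bar R :=
  ereal_sup [set (hnorm (A x))%:E | x in [set x | hnorm x <= 1]]%classic.

(* Boundedness is not required: it follows, since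
   |A x|^2 = <A x, A x> = <A (A x), x> = |x|^2. *)
Definition is_reflection (A : {linear V -> V}) : Prop :=
  (forall x y, dot (A x) y = dot x (A y)) /\ (forall x, A (A x) = x).

Definition is_qubit (X Z : {linear V -> V}) : Prop :=
  [/\ is_reflection X, is_reflection Z & forall x, X (Z x) + Z (X x) = 0].

Definition commuting (A B : V -> V) : Prop := forall x, A (B x) = B (A x).

Definition independent_qubits (n : nat) (X Z : 'I_n -> {linear V -> V}) : Prop :=
  forall i j, i != j ->
    [/\ commuting (X i) (X j), commuting (X i) (Z j),
        commuting (Z i) (X j) & commuting (Z i) (Z j)].

Definition qubit_op (X Z : V -> V) (a b c d : R[i]) : V -> V :=
  fun x => a *: x + b *: X x + c *: Z x + d *: ('i%C *: X (Z x)).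

(* [op_prod U x] is U 0 (U 1 (... (U k.-1 x))). *)
Definition op_prod (k : nat) (U : 'I_k -> V -> V) (x : V) : V :=
  foldr (fun l => U l) x (enum 'I_k).

(* Outcomes are encoded by sign bits: the outcome of [b] is (-1) ^+ b, so
   [false] stands for +1 and [true] for -1. *)
Definition outcome_part (A : V -> V) (b : bool) (phi : V) : V :=
  2^-1 *: (phi + (-1) ^+ b *: A phi).

Definition outcome_prob (A : V -> V) (b : bool) (phi : V) : R :=
  hnorm (outcome_part A b phi) ^+ 2.

(* This is 0 when the outcome has probability 0. *)
Definition outcome_state (A : V -> V) (b : bool) (phi : V) : V :=
  ((hnorm (outcome_part A b phi))^-1)%:C *: outcome_part A b phi.

(* The expected value of [f outcome state] after measuring [A] on [phi]. *)
Definition measure (A : V -> V) (phi : V) (f : bool -> V -> R) : R :=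
  \sum_(b : bool) outcome_prob A b phi * f b (outcome_state A b phi).

(* The same for successive measurements, head of the sequence first; [f] gets
   the list of outcomes in chronological order. *)
Fixpoint measure_seq (As : seq {linear V -> V}) (phi : V)
    (f : seq bool -> V -> R) : R :=
  if As is A :: As' then
    measure A phi (fun b phi' => measure_seq As' phi' (fun bs => f (b :: bs)))
  else f [::] phi.

(* Acceptance probability given the order A_0, B_0, A_1, B_1, ...; the first
   outcome of B_j then has position 2j+1 in the list of outcomes. *)
Definition accept_prob_order (n : nat) (A B : 'I_n -> {linear V -> V})
    (psi : V) : R :=
  measure_seq (flatten [seq [:: A j; B j] | j <- enum 'I_n]) psi
    (fun bs phi => n%:R^-1 * \sum_(j < n)
       measure (B j) phi (fun b _ => (b == nth false bs j.*2.+1)%:R)).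

Definition accept_prob (n : nat) (X Z : 'I_n -> {linear V -> V}) (psi : V) : R :=
  2^-1 * accept_prob_order X Z psi + 2^-1 * accept_prob_order Z X psi.

End InnerProduct.

(* The Hilbert direct sum of copies of V indexed by a finite type T, i.e.
   V (x) C^T, where f stands for \sum_t f t (x) |t>. *)
Section DirectSum.
Variables (R : realType) (V : lmodType R[i]) (dot : {dot V for @conjC R[i]}).
Variable T : finType.

Definition sumdot (f g : {ffun T -> V}) : R[i] := \sum_(t : T) dot (f t) (g t).

Let sumdot_bilinear :
  bilinear_for ( *%R ) (@conjC R[i] \; *%R) sumdot.
Proof.
split=> [g a f1 f2|f a g1 g2]; rewrite /sumdot /= mulr_sumr -big_split /=;
  apply: eq_bigr => t _; rewrite !ffunE.
- by rewrite linearDl linearZl_LR.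
- by rewrite linearDr linearZr_LR.
Qed.

HB.instance Definition _ := bilinear_isBilinear.Build _ _ _ _ _ _ sumdot
  sumdot_bilinear.

Let sumdot_hermitian (f g : {ffun T -> V}) :
  sumdot f g = (-1) ^+ false * @conjC R[i] (sumdot g f).
Proof.
rewrite expr0 mul1r rmorph_sum; apply: eq_bigr => t _ /=.
by rewrite hermC expr0 mul1r.
Qed.

HB.instance Definition _ := isHermitianSesquilinear.Build _ _ _ _ sumdot
  sumdot_hermitian.

Let sumdot_gt0 (f : {ffun T -> V}) : f != 0 -> 0 < sumdot f f.
Proof.
move=> f0; rewrite lt_def sumr_ge0 ?andbT => [|t _]; last exact: dnorm_ge0.
apply: contra f0 => /eqP s0; apply/eqP/ffunP => t; rewrite ffunE; apply/eqP.
rewrite -(dnorm_eq0 dot); move: s0 => /eqP; rewrite psumr_eq0; last first.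
  by move=> u _; exact: dnorm_ge0.
by move=> /allP /(_ t); rewrite mem_index_enum => /(_ isT).
Qed.

HB.instance Definition _ := isDotProduct.Build _ _ sumdot sumdot_gt0.

End DirectSum.

(* A computational basis vector of (C^2)^{(x) 2n}: [a j] holds the basis states
   of the registers j' and j''. *)
Notation registers n := {ffun 'I_n -> ('I_2 * 'I_2)%type}.

Notation with_registers V n := {ffun registers n -> V}.

Section Swap.
Variables (R : realType) (V : lmodType R[i]) (n : nat).

Definition mx22 (a b c d : R[i]) : 'M[R[i]]_2 :=
  \matrix_(i, j) (if i == ord0 then (if j == ord0 then a else b)
                  else (if j == ord0 then c else d)).

Definition sigma_x : 'M[R[i]]_2 := mx22 0 1 1 0.
Definition sigma_y : 'M[R[i]]_2 := mx22 0 (- 'i%C) 'i%C 0.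
Definition sigma_z : 'M[R[i]]_2 := mx22 1 0 0 (-1).

Definition set_prime (a : registers n) (j : 'I_n) (t : 'I_2) : registers n :=
  [ffun i => if i == j then (t, (a i).2) else a i].

(* A (x) M, where the matrix M acts on the register j'. *)
Definition tensor_op (A : V -> V) (j : 'I_n) (M : 'M[R[i]]_2)
    (f : with_registers V n) : with_registers V n :=
  [ffun a : registers n => \sum_(t < 2) M (a j).1 t *: A (f (set_prime a j t))].

Definition extend_op (A : V -> V) (f : with_registers V n) :
  with_registers V n := [ffun a : registers n => A (f a)].

Definition swap (X Z : 'I_n -> {linear V -> V}) (j : 'I_n)
    (f : with_registers V n) : with_registers V n :=
  2^-1 *: (f + tensor_op (X j) j sigma_x f + tensor_op (Z j) j sigma_z f
             + 'i%C *: tensor_op (X j \o Z j) j sigma_y f).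

(* The amplitudes of (|00> + |11>) / sqrt 2. *)
Definition EPR (t : 'I_2 * 'I_2) : R[i] :=
  ((Num.sqrt (2 : R))^-1)%:C * (t.1 == t.2)%:R.

Definition Psi0 (psi : V) : with_registers V n :=
  [ffun a : registers n => (\prod_(j < n) EPR (a j)) *: psi].

Definition Psi (X Z : 'I_n -> {linear V -> V}) (psi : V) : with_registers V n :=
  foldl (fun f j => swap X Z j f) (Psi0 psi) (enum 'I_n).

End Swap.

(* Main.v *)
(* Swapping the qubit j with one half of an EPR pair twirls it: on the space of
   the state, the swap acts like the two measurements of step (1).  Afterwards
   the qubit is maximally entangled with the register j'', so that X_j Psi = x''_j
   Psi and Z_j Psi = z''_j Psi would hold if the later swaps left the qubit alone.
   The correlation <Psi, Z_j z''_j Psi> is exactly the one between the two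
   measurements of Z_j in the protocol, whence
     Pr[accept] = 1/2 + 1/(4n) sum_j (<Psi, X_j x''_j Psi> + <Psi, Z_j z''_j Psi>)
   and |X_j Psi - x''_j Psi|, |Z_j Psi - z''_j Psi| <= sqrt (8 n eps).
   With W the product of the swaps, the qubits Xh_j = W x'_j W^-1 and Zh_j = W z'_j
   W^-1 are exactly independent.  Since W commutes with the registers j'' and
   x'_j = x''_j on the EPR state, Xh_j Psi = x''_j Psi exactly.  So both U_j and its
   hatted version can be replaced on Psi by the same operator on j'' (the transpose
   of U_j), which commutes with all the other factors; replacing the factors one
   at a time gives the bound. *)
Require Import Defs.
From HB Require Import structures.
From mathcomp Require Import all_boot all_order all_algebra.
From mathcomp Require Import complex.
From mathcomp Require Import boolp classical_sets reals ereal topology normedtype.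
From mathcomp Require Import ring lra.

Set Implicit Arguments.
Unset Strict Implicit.
Unset Printing Implicit Defensive.

Import Order.TTheory GRing.Theory Num.Theory Num.Def.
Import numFieldNormedType.Exports.

Local Open Scope ring_scope.
Local Open Scope complex_scope.

(** * The real part of the inner product *)

Section RealInnerProduct.
Variables (R : realType) (V : lmodType R[i]) (dot : {dot V for @conjC R[i]}).
Local Notation C := R[i].
Implicit Types (x y z : V) (r : R) (A B : {linear V -> V}).

(** Probabilities and distances only involve this real part, which over real scalars is symmetric
    and bilinear rather than sesquilinear. *)
Definition rdot x y : R := complex.Re (dot x y).

Lemma ReM_real r (z : C) : complex.Re (r%:C * z) = r * complex.Re z.
Proof. by case: z => a b /=; rewrite mul0r subr0. Qed.

Lemma Re_conj (z : C) : complex.Re (conjC z) = complex.Re z.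
Proof. by case: z. Qed.

Lemma conj_real r : conjC (r%:C : C) = r%:C.
Proof. exact: conjc_real. Qed.

Lemma rdotDl x y z : rdot (x + y) z = rdot x z + rdot y z.
Proof. by rewrite /rdot linearDl raddfD. Qed.

Lemma rdotDr x y z : rdot x (y + z) = rdot x y + rdot x z.
Proof. by rewrite /rdot linearDr raddfD. Qed.

Lemma rdotZl r x y : rdot (r%:C *: x) y = r * rdot x y.
Proof. by rewrite /rdot linearZl_LR /= ReM_real. Qed.

Lemma rdotZr r x y : rdot x (r%:C *: y) = r * rdot x y.
Proof. by rewrite /rdot linearZr_LR /= conj_real ReM_real. Qed.

Lemma rdotC x y : rdot x y = rdot y x.
Proof. by rewrite /rdot hermC expr0 mul1r Re_conj. Qed.

Lemma rdot_ge0 x : 0 <= rdot x x.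
Proof.
by have := dnorm_ge0 dot x; rewrite lecE => /andP[_]; rewrite /rdot.
Qed.

Lemma dotE x : dot x x = (rdot x x)%:C.
Proof.
rewrite /rdot [LHS]complexE; have := dnorm_ge0 dot x.
by rewrite lecE => /andP[/eqP /= -> _]; rewrite mulr0 addr0.
Qed.

Lemma sqr_hnorm x : hnorm dot x ^+ 2 = rdot x x.
Proof. by rewrite sqr_sqrtr // rdot_ge0. Qed.

Lemma hnorm_nneg x : 0 <= hnorm dot x.
Proof. exact: sqrtr_ge0. Qed.

Lemma hnorm_eq0P x : hnorm dot x = 0 -> x = 0.
Proof.
move=> x0; apply/eqP; rewrite -(dnorm_eq0 dot) dotE -sqr_hnorm x0 expr0n /=.
by rewrite rmorph0.
Qed.

Lemma hnormZ (c : C) x : hnorm dot (c *: x) = complex.Re `|c| * hnorm dot x.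
Proof.
rewrite /hnorm dnormZ -add_Re2_Im2 ReM_real sqrtrM; last first.
  by rewrite addr_ge0 ?sqr_ge0.
by rewrite normc_def.
Qed.

Lemma hnormZr r x : 0 <= r -> hnorm dot (r%:C *: x) = r * hnorm dot x.
Proof.
by move=> r0; rewrite hnormZ normc_def /= expr0n /= addr0 sqrtr_sqr ger0_norm.
Qed.

Lemma hnorm0 : hnorm dot 0 = 0.
Proof. by rewrite -(scale0r 0) -[0]/((0 : R)%:C) hnormZr // mul0r. Qed.

Lemma rdot_le x y : rdot x y <= hnorm dot x * hnorm dot y.
Proof.
set a := hnorm dot x; set b := hnorm dot y.
have [a0|a0] := eqVneq a 0.
  rewrite a0 mul0r (hnorm_eq0P a0) -(scale0r 0) -[0]/((0 : R)%:C).
  by rewrite rdotZl mul0r.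
have [b0|b0] := eqVneq b 0.
  rewrite b0 mulr0 (hnorm_eq0P b0) -(scale0r 0) -[0]/((0 : R)%:C).
  by rewrite rdotZr mul0r.
have ap : 0 < a by rewrite lt_neqAle eq_sym a0 hnorm_nneg.
have bp : 0 < b by rewrite lt_neqAle eq_sym b0 hnorm_nneg.
(* This expands to [2 a^2 b^2 - 2 a b rdot x y >= 0], from which [2 a b] is divided out. *)
have := rdot_ge0 (b%:C *: x + (- a)%:C *: y).
rewrite !(rdotDl, rdotDr, rdotZl, rdotZr) (rdotC y x) -!sqr_hnorm -/a -/b => h.
rewrite -(ler_pM2l (mulr_gt0 ap bp)); nra.
Qed.

Lemma hnorm_triangle x y : hnorm dot (x + y) <= hnorm dot x + hnorm dot y.
Proof.
rewrite -(@ler_pXn2r _ 2) ?nnegrE ?addr_ge0 ?hnorm_nneg //.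
rewrite sqr_hnorm !(rdotDl, rdotDr) (rdotC y x) -!sqr_hnorm.
have := rdot_le x y; nra.
Qed.

Lemma sqr_hnormB x y :
  hnorm dot (x - y) ^+ 2 = rdot x x + rdot y y - 2 * rdot x y.
Proof.
have -> : x - y = x + (-1 : R)%:C *: y by rewrite rmorphN rmorph1 scaleN1r.
rewrite sqr_hnorm !(rdotDl, rdotDr, rdotZl, rdotZr). rewrite (rdotC y x); ring.
Qed.

Lemma rdot_ext x y : (forall z, rdot x z = rdot y z) -> x = y.
Proof.
move=> h; apply/eqP; rewrite -subr_eq0; apply/eqP/hnorm_eq0P.
apply/eqP; rewrite -sqrf_eq0 sqr_hnormB h (rdotC y x) h; apply/eqP; ring.
Qed.

Lemma reflection_rdot A x y : is_reflection dot A ->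
  rdot (A x) (A y) = rdot x y.
Proof. by case=> sA AA; rewrite /rdot sA AA. Qed.

Lemma reflection_hnorm A x : is_reflection dot A -> hnorm dot (A x) = hnorm dot x.
Proof. by move=> rA; rewrite /hnorm -/(rdot _ _) reflection_rdot. Qed.

End RealInnerProduct.

(** * Twirling bilinear forms *)

Section RealBilinear.
Variables (R : realType) (V : lmodType R[i]).
Local Notation C := R[i].
Implicit Types (x y z : V) (r : R) (A B : {linear V -> V}) (g h : V -> V -> R).

Definition real_bilinear g : Prop :=
  [/\ forall x y z, g (x + y) z = g x z + g y z,
      forall x y z, g x (y + z) = g x y + g x z,
      forall r x y, g (r%:C *: x) y = r * g x y &
      forall r x y, g x (r%:C *: y) = r * g x y].

(** On the diagonal, the expectation of [g] after measuring [A] and forgetting the outcome (see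
    [sum_outcome]). *)
Definition average A g x y : R := 2^-1 * (g x y + g (A x) (A y)).

Definition twirl A B g := average A (average B g).

(* The polarization identity turns the difference of [g] on the two outcomes
   of a measurement of [B] into this form. *)
Definition insert B g x y : R := 2^-1 * (g x (B y) + g (B x) y).

Lemma real_bilinear_comp A B g :
  real_bilinear g -> real_bilinear (fun x y => g (A x) (B y)).
Proof.
case=> dl dr zl zr; split=> [x y z|x y z|r x y|r x y].
- by rewrite linearD dl.
- by rewrite linearD dr.
- by rewrite linearZ zl.
- by rewrite linearZ zr.
Qed.

Lemma real_bilinearP r1 r2 g h : real_bilinear g -> real_bilinear h ->
  real_bilinear (fun x y => r1 * (g x y + r2 * h x y)).
Proof.
move=> [dl dr zl zr] [dl' dr' zl' zr']; split=> [x y z|x y z|r x y|r x y].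
- rewrite dl dl'; ring.
- rewrite dr dr'; ring.
- rewrite zl zl'; ring.
- rewrite zr zr'; ring.
Qed.

Lemma real_bilinear_average A g : real_bilinear g -> real_bilinear (average A g).
Proof.
move=> gb; have := real_bilinearP 2^-1 1 gb (real_bilinear_comp A A gb).
by under [X in real_bilinear X -> _]eq_fun do under eq_fun do rewrite mul1r.
Qed.

Lemma real_bilinear_twirl A B g : real_bilinear g -> real_bilinear (twirl A B g).
Proof. by move=> gb; do 2!apply: real_bilinear_average. Qed.

Lemma real_bilinear_insert A g : real_bilinear g -> real_bilinear (insert A g).
Proof.
move=> gb; have := real_bilinearP 2^-1 1 (real_bilinear_comp idfun A gb)
  (real_bilinear_comp A idfun gb).
by under [X in real_bilinear X -> _]eq_fun do under eq_fun do rewrite mul1r.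
Qed.

Lemma real_bilinearNl g x y : real_bilinear g -> g (- x) y = - g x y.
Proof.
by case=> _ _ zl _; have := zl (-1) x y; rewrite rmorphN rmorph1 scaleN1r mulN1r.
Qed.

Lemma real_bilinearNr g x y : real_bilinear g -> g x (- y) = - g x y.
Proof.
by case=> _ _ _ zr; have := zr (-1) x y; rewrite rmorphN rmorph1 scaleN1r mulN1r.
Qed.

Lemma average_linear A r1 r2 g h :
  average A (fun x y => r1 * (g x y + r2 * h x y)) =
  fun x y => r1 * (average A g x y + r2 * average A h x y).
Proof. apply/funext => x; apply/funext => y; rewrite /average; ring. Qed.

(** Moving [A] past [B] costs a sign in each argument of [g], and the two signs cancel: with
    forgotten outcomes, the order of the two measurements is immaterial. *)
Lemma twirlC A B g : real_bilinear g ->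
  (forall x, A (B x) + B (A x) = 0) -> twirl A B g = twirl B A g.
Proof.
move=> gb anti; apply/funext => x; apply/funext => y; rewrite /twirl /average.
have e z : A (B z) = - B (A z) by apply/eqP; rewrite -addr_eq0 anti.
by rewrite !e real_bilinearNl // real_bilinearNr // opprK; ring.
Qed.

Lemma outcome_partT A x :
  outcome_part A true x = (2^-1 : R)%:C *: (x + (-1 : R)%:C *: A x).
Proof. by rewrite /outcome_part expr1 !(rmorphN, rmorph1, fmorphV, rmorph_nat). Qed.

Lemma outcome_partF A x :
  outcome_part A false x = (2^-1 : R)%:C *: (x + A x).
Proof.
by rewrite /outcome_part expr0 scale1r !(rmorphN, rmorph1, fmorphV, rmorph_nat).
Qed.

Definition outcome_partE := (outcome_partT, outcome_partF).

Lemma outcome_partZ A b (c : C) x :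
  outcome_part A b (c *: x) = c *: outcome_part A b x.
Proof.
rewrite /outcome_part linearZ /= [_ *: (c *: A x)]scalerA [_ * c]mulrC.
by rewrite -[(c * _) *: _]scalerA -scalerDr !scalerA mulrC.
Qed.

(** The cross terms have opposite signs for the two outcomes and cancel. *)
Lemma sum_outcome A g x y : real_bilinear g ->
  g (outcome_part A true x) (outcome_part A true y) +
  g (outcome_part A false x) (outcome_part A false y) = average A g x y.
Proof.
by case=> dl dr zl zr; rewrite !outcome_partE !(zl, zr, dl, dr) /average; field.
Qed.

(** Here the diagonal terms cancel and the cross terms remain. *)
Lemma sub_outcome A g x y : real_bilinear g ->
  g (outcome_part A false x) (outcome_part A false y) -
  g (outcome_part A true x) (outcome_part A true y) = insert A g x y.
Proof.
by case=> dl dr zl zr; rewrite !outcome_partE !(zl, zr, dl, dr) /insert; field.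
Qed.

Section Twirls.
Variables (I : Type) (A B : I -> {linear V -> V}).

(** The head of [s] is the outermost twirl, that is, the pair measured first. *)
Definition twirls (s : seq I) g := foldr (fun j => twirl (A j) (B j)) g s.

Lemma real_bilinear_twirls s g : real_bilinear g -> real_bilinear (twirls s g).
Proof. by move=> gb; elim: s => //= j s; apply: real_bilinear_twirl. Qed.

Lemma twirls_linear s r1 r2 g h :
  twirls s (fun x y => r1 * (g x y + r2 * h x y)) =
  fun x y => r1 * (twirls s g x y + r2 * twirls s h x y).
Proof. by elim: s => //= j s ->; rewrite /twirl !average_linear. Qed.

End Twirls.

Lemma eq_twirls (I : Type) (A B : I -> {linear V -> V}) s g :
  real_bilinear g -> (forall j x, A j (B j x) + B j (A j x) = 0) ->
  twirls A B s g = twirls B A s g.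
Proof.
move=> gb anti; elim: s => //= j s ->.
by apply: twirlC (anti j); apply: real_bilinear_twirls.
Qed.

End RealBilinear.

(** * The acceptance probability *)

Section Acceptance.
Variables (R : realType) (V : lmodType R[i]) (dot : {dot V for @conjC R[i]}).
Local Notation rdot := (rdot dot).
Implicit Types (x y z : V) (r : R) (A B : {linear V -> V}).

Lemma real_bilinear_rdot : real_bilinear rdot.
Proof.
by split=> *; rewrite ?rdotDl ?rdotDr ?rdotZl ?rdotZr.
Qed.

Lemma average_rdot A : is_reflection dot A -> average A rdot = rdot.
Proof.
move=> rA; apply/funext => x; apply/funext => y; rewrite /average.
by rewrite reflection_rdot //; field.
Qed.

Lemma twirls_rdot (I : Type) (A B : I -> {linear V -> V}) s :
  (forall j, is_reflection dot (A j)) -> (forall j, is_reflection dot (B j)) ->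
  twirls A B s rdot = rdot.
Proof. by move=> rA rB; elim: s => //= j s ->; rewrite /twirl !average_rdot. Qed.

(* Measurements with unnormalized post-measurement states: equivalent to the
   normalized ones on functions that are homogeneous of degree 2, and free of
   divisions by zero. *)
Fixpoint raw_measure_seq (As : seq {linear V -> V}) x
    (f : seq bool -> V -> R) : R :=
  if As is A :: As' then
    \sum_(b : bool) raw_measure_seq As' (outcome_part A b x) (fun bs => f (b :: bs))
  else f [::] x.

Definition quadratic (f : V -> R) := forall r x, f (r%:C *: x) = r ^+ 2 * f x.

Lemma measureE A x (f : bool -> V -> R) : (forall b, quadratic (f b)) ->
  measure dot A x f = \sum_(b : bool) f b (outcome_part A b x).
Proof.
move=> qf; apply: eq_bigr => b _; rewrite /outcome_prob /outcome_state qf.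
set h := hnorm dot _; have [h0|h0] := eqVneq h 0; last first.
  by rewrite mulrA -exprMn mulfV // expr1n mul1r.
(* An outcome of probability 0 has the zero vector as its part, where a quadratic function
   vanishes. *)
rewrite (hnorm_eq0P h0) -(scale0r 0) -[0]/((0 : R)%:C) qf.
by rewrite h0 !expr0n /= !mul0r.
Qed.

Lemma quadratic_raw_measure_seq As f : (forall bs, quadratic (f bs)) ->
  quadratic (fun x => raw_measure_seq As x f).
Proof.
elim: As f => [|A As IH] f qf r x /=; first exact: qf.
rewrite mulr_sumr; apply: eq_bigr => b _; rewrite outcome_partZ.
by rewrite (IH (fun bs => f (b :: bs))).
Qed.

Lemma measure_seqE As x f : (forall bs, quadratic (f bs)) ->
  measure_seq dot As x f = raw_measure_seq As x f.
Proof.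
elim: As x f => [//|A As IH] x f qf /=.
under eq_fun do under eq_fun do rewrite IH //.
by rewrite measureE // => b; apply: quadratic_raw_measure_seq.
Qed.

Lemma eq_raw_measure_seq As x f f' :
  (forall bs y, size bs = size As -> f bs y = f' bs y) ->
  raw_measure_seq As x f = raw_measure_seq As x f'.
Proof.
elim: As x f f' => [|A As IH] x f f' ff' /=; first exact: ff'.
apply: eq_bigr => b _; apply: IH => bs y sbs.
by rewrite ff' //= sbs.
Qed.

Lemma raw_measure_seq_cat As Bs x f :
  raw_measure_seq (As ++ Bs) x f =
  raw_measure_seq As x (fun bs y => raw_measure_seq Bs y (fun cs => f (bs ++ cs))).
Proof. by elim: As x f => [//|A As IH] x f /=; apply: eq_bigr => b _; rewrite IH. Qed.

Lemma raw_measure_seq_sum (I : finType) As x c (F : I -> seq bool -> V -> R) :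
  raw_measure_seq As x (fun bs y => c * \sum_i F i bs y) =
  c * \sum_i raw_measure_seq As x (F i).
Proof.
elim: As x F => [//|A As IH] x F /=; under eq_bigr do rewrite IH.
by rewrite -mulr_sumr exchange_big.
Qed.

Definition pairs (I : Type) (A B : I -> {linear V -> V}) (s : seq I) :=
  flatten [seq [:: A j; B j] | j <- s].

Lemma size_pairs (I : Type) (A B : I -> {linear V -> V}) s :
  size (pairs A B s) = (size s).*2.
Proof. by elim: s => //= j s ->. Qed.

Lemma raw_measure_pairs (I : Type) (A B : I -> {linear V -> V}) s x g :
  real_bilinear g ->
  raw_measure_seq (pairs A B s) x (fun _ y => g y y) = twirls A B s g x x.
Proof.
move=> gb; elim: s x => [//|j s IH] x /=.
have tb := real_bilinear_twirls A B s gb.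
under eq_bigr do rewrite big_bool /= !IH (sum_outcome (B j)) //.
by rewrite big_bool /= sum_outcome //; apply: real_bilinear_average.
Qed.

(* The correlation between the two measurements of [B j]. *)
Definition correlation (I : Type) (A B : I -> {linear V -> V}) s1 j s2 x : R :=
  twirls A B s1 (average (A j) (insert (B j)
    (twirls A B s2 (fun y z => rdot y (B j z))))) x x.

(** Two signs agree with probability half of one plus their expected product. All outcomes except
    that of [B j] are forgotten, so they only contribute averages. *)
Lemma raw_measure_repeat (I : Type) (A B : I -> {linear V -> V}) s1 j s2 x :
  (forall j, is_reflection dot (A j)) -> (forall j, is_reflection dot (B j)) ->
  raw_measure_seq (pairs A B (s1 ++ j :: s2)) x (fun bs y =>
    outcome_prob dot (B j) (nth false bs (size s1).*2.+1) y) =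
  2^-1 * (rdot x x + correlation A B s1 j s2 x).
Proof.
move=> rA rB; rewrite /pairs map_cat flatten_cat raw_measure_seq_cat.
pose r := fun y z => rdot y (B j z).
pose G := twirls A B s2 r.
have rb : real_bilinear r := real_bilinear_comp idfun (B j) real_bilinear_rdot.
have Gb : real_bilinear G := real_bilinear_twirls A B s2 rb.
have Db := real_bilinear_insert (B j) Gb.
(* After the outcome [c] of [B j], the pairs in [s2] twirl the form that gives the probability of
   [c] in the last measurement. *)
have inner y c : raw_measure_seq (pairs A B s2) y
    (fun _ => outcome_prob dot (B j) c) =
    2^-1 * (rdot y y + (-1) ^+ c * G y y).
  rewrite (_ : (fun _ : seq bool => _) =
    fun _ z => (fun u v => 2^-1 * (rdot u v + (-1) ^+ c * r u v)) z z).
    rewrite (raw_measure_pairs _ _ _ _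
      (g := fun u v => 2^-1 * (rdot u v + (-1) ^+ c * r u v))).
      by rewrite twirls_linear twirls_rdot.
    exact: real_bilinearP real_bilinear_rdot rb.
  apply/funext => _; apply/funext => z; rewrite /outcome_prob sqr_hnorm.
  have e : rdot (B j z) z = rdot z (B j z) by rewrite rdotC.
  case: c; rewrite outcome_partE !(rdotDl, rdotDr, rdotZl, rdotZr) e
    (reflection_rdot _ _ (rB j)) /r; by field.
pose F u v := 2^-1 * (rdot u v + 1 * average (A j) (insert (B j) G) u v).
rewrite (@eq_raw_measure_seq _ _ _ (fun _ y => F y y)).
  rewrite raw_measure_pairs; last first.
    exact: real_bilinearP real_bilinear_rdot (real_bilinear_average _ Db).
  by rewrite twirls_linear twirls_rdot // mul1r.
move=> bs y; rewrite size_pairs => sbs.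
(* The outcomes of [s1] fill the positions below [2 * size s1]; the next is [c] for [A j], and the
   one read is [c'] for [B j]. *)
have step c c' z : raw_measure_seq (pairs A B s2) z (fun cs =>
    outcome_prob dot (B j) (nth false (bs ++ [:: c, c' & cs]) (size s1).*2.+1)) =
    2^-1 * (rdot z z + (-1) ^+ c' * G z z).
  rewrite -inner; apply: eq_raw_measure_seq => cs u _.
  by rewrite nth_cat sbs ltnNge leqnSn /= subSn // subnn.
rewrite /= !big_bool /= !step.
have sumN u := sum_outcome (B j) u u real_bilinear_rdot.
have subG u := sub_outcome (B j) u u Gb.
pose q u := 2^-1 * (rdot u u + insert (B j) G u u).
(* Summed over the outcome of [B j], the norms add up and the signed values of [G] form
   [insert (B j) G]. *)
have E u : 2^-1 * (rdot (outcome_part (B j) true u) (outcome_part (B j) true u) +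
    (-1) ^+ true * G (outcome_part (B j) true u) (outcome_part (B j) true u)) +
  2^-1 * (rdot (outcome_part (B j) false u) (outcome_part (B j) false u) +
    (-1) ^+ false * G (outcome_part (B j) false u) (outcome_part (B j) false u))
  = q u.
  rewrite /q -subG -[rdot u u in RHS](congr1 (fun f => f u u) (average_rdot (rB j))).
  by rewrite -sumN; ring.
rewrite !E /q /F mul1r -[rdot y y](congr1 (fun f => f y y) (average_rdot (rA j))).
rewrite -!sum_outcome //; last exact: real_bilinear_rdot.
by ring.
Qed.


Lemma quadratic_outcome_prob A b : quadratic (outcome_prob dot A b).
Proof.
move=> r x; rewrite /outcome_prob outcome_partZ !sqr_hnorm rdotZl rdotZr; ring.
Qed.

Lemma accept_prob_orderE (n : nat) (A B : 'I_n -> {linear V -> V}) x :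
  (forall j, is_reflection dot (A j)) -> (forall j, is_reflection dot (B j)) ->
  accept_prob_order dot A B x = n%:R^-1 * \sum_(j < n) 2^-1 *
    (rdot x x + correlation A B (take j (enum 'I_n)) j (drop j.+1 (enum 'I_n)) x).
Proof.
move=> rA rB; rewrite /accept_prob_order.
pose F j bs y := outcome_prob dot (B j) (nth false bs j.*2.+1) y.
(* The expected indicator of agreement is the probability of the recorded outcome. *)
have E bs y : n%:R^-1 * \sum_(j < n)
    measure dot (B j) y (fun b _ => (b == nth false bs j.*2.+1)%:R) =
    n%:R^-1 * \sum_(j < n) F j bs y.
  congr (_ * _); apply: eq_bigr => j _; rewrite /measure /F big_bool.
  by case: (nth _ _ _); rewrite /= mulr0 mulr1 ?addr0 ?add0r.
rewrite (_ : (fun _ _ => _) = fun bs y => n%:R^-1 * \sum_(j < n) F j bs y); last first.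
  by apply/funext => bs; apply/funext => y; exact: E.
rewrite measure_seqE; last first.
  move=> bs r y; rewrite [RHS]mulrCA; congr (_ * _); rewrite mulr_sumr.
  by apply: eq_bigr => j _; exact: quadratic_outcome_prob.
rewrite raw_measure_seq_sum; congr (_ * _); apply: eq_bigr => j _.
have sz : size (take j (enum 'I_n)) = j by rewrite size_takel // size_enum_ord ltnW.
rewrite -raw_measure_repeat // sz; congr (raw_measure_seq _ _ _).
rewrite /pairs; congr (flatten (map _ _)).
by rewrite -[LHS](cat_take_drop j) (drop_nth j) ?size_enum_ord // nth_ord_enum.
Qed.

End Acceptance.

(** * Sums over register bits *)

Lemma sum_bit (M : nmodType) (F : 'I_2 -> M) :
  \sum_(t < 2) F t = F ord0 + F ord_max.
Proof.
rewrite big_ord_recl big_ord1; congr (_ + F _); exact: val_inj.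
Qed.

Lemma sum_bits (M : nmodType) (F : 'I_2 * 'I_2 -> M) :
  \sum_t F t = F (ord0, ord0) + F (ord0, ord_max) +
               (F (ord_max, ord0) + F (ord_max, ord_max)).
Proof.
rewrite (eq_bigr (fun t => F (t.1, t.2))) => [|[]] //.
by rewrite -(pair_bigA _ (fun i j => F (i, j))) /= !sum_bit.
Qed.

Lemma bitP (t : 'I_2) : t = ord0 \/ t = ord_max.
Proof. by case: t => [[|[|]]] // i; [left|right]; exact: val_inj. Qed.

Lemma rev_bit0 : rev_ord (ord0 : 'I_2) = ord_max. Proof. exact: val_inj. Qed.

Lemma rev_bit1 : rev_ord (ord_max : 'I_2) = ord0. Proof. exact: val_inj. Qed.

(** * The swapped state *)

Section Registers.
Variables (n : nat) (R : realType).
Implicit Types (a : registers n) (j : 'I_n).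

Definition set_reg a j (t : 'I_2 * 'I_2) : registers n :=
  [ffun i => if i == j then t else a i].

Lemma set_reg_eq a j t : set_reg a j t j = t.
Proof. by rewrite ffunE eqxx. Qed.

Lemma set_reg_neq a j t i : i != j -> set_reg a j t i = a i.
Proof. by rewrite ffunE => /negPf ->. Qed.

(** Exchanging [a j] with [t] is an involution on the pairs [(a, t)]. It turns the summand into
    [G a], counted once for each of the 4 values of [t]. *)
Lemma sum_set_reg (G : registers n -> R) j :
  \sum_a \sum_t G (set_reg a j t) = 4 * \sum_a G a.
Proof.
pose h (p : registers n * ('I_2 * 'I_2)) := (set_reg p.1 j p.2, p.1 j).
have hK : involutive h.
  move=> [a t]; rewrite /h /= set_reg_eq; congr pair.
  by apply/ffunP => i; rewrite !ffunE; case: eqP => [->|].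
rewrite (pair_bigA _ (fun a t => G (set_reg a j t))) /=.
transitivity (\sum_(p : registers n * ('I_2 * 'I_2)) G p.1).
  by rewrite [RHS](reindex_inj (inv_inj hK)).
rewrite -(pair_bigA _ (fun a (t : 'I_2 * 'I_2) => G a)) /= mulr_sumr.
by apply: eq_bigr => a _; rewrite sumr_const card_prod !card_ord mulr_natl.
Qed.

End Registers.

(** * Kraus operators of a swap with half of an EPR pair *)

Section Kraus.
Variables (R : realType) (V : lmodType R[i]).
Local Notation C := R[i].
Implicit Types (x y z : V) (X Z : {linear V -> V}) (g h : V -> V -> R).

(* Up to a factor [sqrt 2], the amplitude on the basis vector [t] of the
   registers j', j'' after swapping [x] into the first half of an EPR pair. *)
Definition kraus X Z (t : 'I_2 * 'I_2) x : V :=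
  let p := outcome_part Z (t.1 != ord0) x in if t.1 == t.2 then p else X p.

Lemma krausZ X Z t (c : C) x : kraus X Z t (c *: x) = c *: kraus X Z t x.
Proof. by rewrite /kraus /= outcome_partZ; case: ifP => // _; rewrite linearZ. Qed.

(** [t.1] is an outcome of [Z], and [t.1 == t.2] tells whether [X] follows; summing over both gives
    the two averages. *)
Lemma sum_kraus X Z g x y : real_bilinear g ->
  \sum_t g (kraus X Z t x) (kraus X Z t y) = 2 * twirl Z X g x y.
Proof.
move=> gb; rewrite sum_bits /kraus /= addrC.
rewrite [X in X + _]addrC addrACA (sum_outcome _ _ _ gb).
rewrite (sum_outcome _ _ _ (real_bilinear_comp X X gb)).
by rewrite /twirl /average; field.
Qed.

(** For [t.1 = t.2] the sign is the outcome of [Z]; otherwise it is the opposite, but moving [Z]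
    past [X] gives a second sign. So the two halves add up. *)
Lemma sum_kraus_sign X Z g x y : real_bilinear g ->
  (forall z, X (Z z) + Z (X z) = 0) ->
  \sum_t g (kraus X Z t x) (((-1) ^+ t.2 : R)%:C *: kraus X Z t y) =
  2 * average X (insert Z g) x y.
Proof.
move=> gb anti; have [_ _ _ zr] := gb.
have e z : Z (X z) = - X (Z z) by apply/eqP; rewrite -addr_eq0 addrC anti.
under eq_bigr do rewrite zr.
rewrite sum_bits /kraus /= expr0 expr1 !mul1r !mulN1r.
have := sub_outcome Z x y gb.
have := sub_outcome Z x y (real_bilinear_comp X X gb).
rewrite /average /insert !e (real_bilinearNl _ _ gb) (real_bilinearNr _ _ gb).
lra.
Qed.

(** Flipping [t.2] exchanges the branches with and without [X], so each outcome of [Z] contributes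
    the cross terms of [insert X g]. *)
Lemma sum_kraus_flip X Z g x y : real_bilinear g ->
  \sum_t g (kraus X Z t x) (kraus X Z (t.1, rev_ord t.2) y) =
  2 * average Z (insert X g) x y.
Proof.
move=> gb; rewrite sum_bits /kraus [(_, _).2]/= [(_, ord_max).2]/=.
rewrite !(rev_bit0, rev_bit1) /=.
have := sum_outcome Z x y (real_bilinear_insert X gb); rewrite {1 2}/insert; lra.
Qed.

Variables (n : nat) (X Z : 'I_n -> {linear V -> V}).
Local Notation K j := (kraus (X j) (Z j)).

Definition kraus_path (s : seq 'I_n) (a : registers n) x : V :=
  foldl (fun x j => K j (a j) x) x s.

Lemma kraus_pathZ s a (c : C) x :
  kraus_path s a (c *: x) = c *: kraus_path s a x.
Proof. by elim: s x => //= j s IH x; rewrite krausZ IH. Qed.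

Lemma eq_kraus_path (s : seq 'I_n) (a b : registers n) x : {in s, a =1 b} ->
  kraus_path s a x = kraus_path s b x.
Proof.
elim: s x => //= j s IH x ab; rewrite ab ?mem_head //.
by apply: IH => i si; rewrite ab // inE si orbT.
Qed.

(** As [f] and [h] ignore the registers in [s], each [a j] can be resampled: [sum_kraus] yields a
    twirl with factor 2, against 4 register values, which leaves one half per index. *)
Lemma sum_kraus_path s g (f h : registers n -> V) : uniq s -> real_bilinear g ->
  (forall j a t, j \in s -> f (set_reg a j t) = f a) ->
  (forall j a t, j \in s -> h (set_reg a j t) = h a) ->
  \sum_a g (kraus_path s a (f a)) (kraus_path s a (h a)) =
  2 ^- size s * \sum_a twirls Z X s g (f a) (h a).
Proof.
move=> + gb; elim: s f h => [|j s IH] f h /=.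
  by rewrite expr0 invr1 mul1r.
move=> /andP[js us] fP hP.
rewrite (IH (fun a => K j (a j) (f a)) (fun a => K j (a j) (h a)) us); first last.
- move=> i a t si; rewrite set_reg_neq ?hP ?inE ?si ?orbT //.
  by apply: contraNneq js => ->.
- move=> i a t si; rewrite set_reg_neq ?fP ?inE ?si ?orbT //.
  by apply: contraNneq js => ->.
pose G (a : registers n) := twirls Z X s g (K j (a j) (f a)) (K j (a j) (h a)).
have E : \sum_a \sum_t G (set_reg a j t) =
    2 * \sum_(a : registers n) twirls Z X (j :: s) g (f a) (h a).
  rewrite mulr_sumr; apply: eq_bigr => a _ /=.
  rewrite -(sum_kraus _ _ _ _ (real_bilinear_twirls _ _ _ gb)).
  by apply: eq_bigr => t _; rewrite /G set_reg_eq fP ?hP ?mem_head.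
move: E; rewrite sum_set_reg /= => E.
rewrite -[X in _ * X = _](mulKf (_ : 4 != 0 :> R)) ?pnatr_eq0 // E exprS invfM.
by field.
Qed.

End Kraus.

(** * Amplitudes of the swapped state *)

Section SwappedState.
Variables (R : realType) (V : lmodType R[i]) (dot : {dot V for @conjC R[i]}).
Variables (n : nat) (X Z : 'I_n -> {linear V -> V}).
Local Notation C := R[i].
Local Notation rdot := (rdot dot).
Local Notation amp := ((Num.sqrt (2 : R))^-1).
Local Notation path := (kraus_path X Z).
Implicit Types (a : registers n) (j : 'I_n) (x y : V) (g : V -> V -> R).

(** The registers j' and j'' of [f] agree, as in an EPR pair. Hence only the identity and [Z] terms
    of the swap reach equal bits, and only the [X] and [XZ] terms reach different ones;
    ['i * sigma_y] is real. *)
Lemma swap_kraus j (f : with_registers V n) a x :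
  (forall t, f (set_prime a j t) = (t == (a j).2)%:R *: x) ->
  swap X Z j f a = kraus (X j) (Z j) (a j) x.
Proof.
move=> fE; have fa : f a = ((a j).1 == (a j).2)%:R *: x.
  rewrite -fE; congr (f _); apply/ffunP => i; rewrite ffunE.
  by case: eqP => [->|//]; case: (a j).
rewrite /swap /tensor_op !ffunE !sum_bit !fE fa /= !mxE /= /kraus.
case: (a j) => t u /=; case: (bitP t) => ->; case: (bitP u) => -> /=;
  rewrite /outcome_part /= ?expr0 ?expr1 ?scale0r ?scale1r ?linear0 ?scaler0
    ?addr0 ?add0r //.
all: rewrite ?scalerA ?mulrN ?mulNr -?expr2 ?sqr_i ?opprK ?scale1r.
all: rewrite ?linearZ ?linearD ?linearZ //=.
all: by rewrite ?scaleN1r ?linearN //= !(scaler0, addr0, scalerBr, scalerDr).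
Qed.

Lemma set_prime_path (s : seq 'I_n) a j t x : j \notin s ->
  path s (set_prime a j t) x = path s a x.
Proof.
move=> js; apply: eq_kraus_path => i si; rewrite ffunE.
by case: eqP si js => // -> ->.
Qed.

(** The registers outside [s] are still in EPR states, so [swap_kraus] applies to the next index and
    turns its EPR factor into one [amp]. *)
Lemma foldl_swap (s : seq 'I_n) a x : uniq s ->
  foldl (fun f j => swap X Z j f) (Psi0 n x) s a =
  (\prod_(i | i \notin s) EPR R (a i) * amp%:C ^+ size s) *: path s a x.
Proof.
elim/last_ind: s a => [|s j IH] a.
  by rewrite /Psi0 ffunE expr0 mulr1.
rewrite rcons_uniq => /andP[js us]; rewrite /kraus_path !foldl_rcons -krausZ.
apply: swap_kraus => t; rewrite IH // -/(path _ _ _) set_prime_path // scalerA.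
congr (_ *: _); rewrite size_rcons exprS (bigD1 j) //= ffunE eqxx /EPR /=.
rewrite [X in _ * X * _ = _](_ : _ = \prod_(i | i \notin rcons s j) EPR R (a i)).
  ring.
apply: eq_big => [i|i /andP[_ /negPf ij]]; last by rewrite ffunE ij.
by rewrite mem_rcons inE negb_or andbC.
Qed.

Lemma Psi_kraus_path x a :
  Psi X Z x a = (amp ^+ n)%:C *: path (enum 'I_n) a x.
Proof.
rewrite /Psi foldl_swap ?enum_uniq // size_enum_ord big_pred0.
  by rewrite mul1r rmorphXn.
by move=> i; rewrite mem_enum.
Qed.

Lemma amp_sqr : amp ^+ n * amp ^+ n = 2 ^- n.
Proof. by rewrite -exprMn -invfM -expr2 sqr_sqrtr // exprVn. Qed.

Lemma kraus_path_cat (s1 : seq 'I_n) j s2 a x :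
  path (s1 ++ j :: s2) a x =
  path s2 a (kraus (X j) (Z j) (a j) (path s1 a x)).
Proof. by rewrite /kraus_path foldl_cat. Qed.

(** The weights cancel: [2^-n] from the squared amplitudes, [2^-n] from [sum_kraus_path], and [4^n]
    basis vectors. *)
Lemma sum_Psi x g : real_bilinear g ->
  \sum_a g (Psi X Z x a) (Psi X Z x a) = twirls Z X (enum 'I_n) g x x.
Proof.
move=> gb; have [_ _ zl zr] := gb.
under eq_bigr do rewrite !Psi_kraus_path zl zr mulrA amp_sqr.
rewrite -mulr_sumr (sum_kraus_path _ _ _ (f := fun=> x) (h := fun=> x)) ?enum_uniq //.
rewrite sumr_const card_ffun card_prod !card_ord size_enum_ord.
rewrite -[_ *+ (_ ^ _)]mulr_natl natrX.
rewrite natrM exprMn; field; exact: expf_neq0.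
Qed.

(** The swaps before and after [j] twirl as in [sum_Psi]; only at [j] do the two arguments differ,
    through [f] and [h], so that [D] takes the place of the twirl there. *)
Lemma sum_kraus_path_split (s1 : seq 'I_n) j s2 x g
    (f h : 'I_2 * 'I_2 -> V -> V) (D : V -> V -> R) :
  enum 'I_n = s1 ++ j :: s2 -> real_bilinear g -> real_bilinear D ->
  (forall y z, \sum_t twirls Z X s2 g (f t y) (h t z) = 2 * D y z) ->
  \sum_a g (path s2 a (f (a j) (path s1 a x))) (path s2 a (h (a j) (path s1 a x))) =
  2 ^+ n * twirls Z X s1 D x x.
Proof.
move=> eqs gb Db fh.
have /and3P[u1 us /andP[js2 u2]] :
    [&& uniq s1, ~~ has (mem s1) (j :: s2) & uniq (j :: s2)].
  by rewrite -cat_uniq -eqs enum_uniq.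
have out i : i \in j :: s2 -> i \notin s1.
  by apply: contraL => i1; apply: contra us => i2; apply/hasP; exists i.
have sz : n = (size s1 + (size s2).+1)%N.
  by rewrite -[LHS](size_enum_ord n) eqs size_cat.
have pow : 2 ^+ n = 2 ^+ size s1 * 2 ^+ size s2 * 2 :> R.
  by rewrite -exprD -exprSr -addnS; congr (_ ^+ _); exact: sz.
have pathP i a t : i \in j :: s2 -> path s1 (set_reg a i t) x = path s1 a x.
  move=> /out i1; apply: eq_kraus_path => k ks1; rewrite set_reg_neq //.
  by apply: contraNneq i1 => <-.
rewrite (sum_kraus_path _ _ _ (f := fun a => f (a j) (path s1 a x))
  (h := fun a => h (a j) (path s1 a x))) //; first last.
- move=> i a t is2; rewrite pathP ?inE ?is2 ?orbT // set_reg_neq //.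
  by apply: contraNneq js2 => ->.
- move=> i a t is2; rewrite pathP ?inE ?is2 ?orbT // set_reg_neq //.
  by apply: contraNneq js2 => ->.
pose G a := twirls Z X s2 g (f (a j) (path s1 a x)) (h (a j) (path s1 a x)).
have E : \sum_a \sum_t G (set_reg a j t) =
    2 * \sum_a D (path s1 a x) (path s1 a x).
  rewrite mulr_sumr; apply: eq_bigr => a _ /=; rewrite -fh.
  by apply: eq_bigr => t _; rewrite /G set_reg_eq pathP ?mem_head.
move: E; rewrite sum_set_reg (sum_kraus_path _ _ _ (f := fun=> x) (h := fun=> x)) //.
rewrite sumr_const card_ffun card_prod !card_ord.
rewrite -[_ *+ (_ ^ _)]mulr_natl natrX natrM exprMn => E.
transitivity (2 ^- size s2 * \sum_a G a) => //.
have -> : \sum_a G a = (2 * 2)^-1 * (2 * 2 * \sum_a G a) by field.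
rewrite E pow; field.
by rewrite !expf_neq0.
Qed.

Definition flip_reg a j := set_reg a j ((a j).1, rev_ord (a j).2).

Hypothesis anti : forall j x, X j (Z j x) + Z j (X j x) = 0.

(** The sign on j'' inserts [Z j] by [sum_kraus_sign]. The swaps twirl in the order Z, X whereas Z
    is remeasured after the order X, Z; [eq_twirls] reconciles the two. *)
Lemma sum_Psi_sign (s1 : seq 'I_n) j s2 x : enum 'I_n = s1 ++ j :: s2 ->
  \sum_a rdot (Psi X Z x a)
    (Z j (((-1) ^+ (a j).2 : R)%:C *: Psi X Z x a)) =
  correlation dot X Z s1 j s2 x.
Proof.
move=> eqs; pose r y z := rdot y (Z j z).
have rb : real_bilinear r := real_bilinear_comp idfun (Z j) (real_bilinear_rdot dot).
have [_ _ zl zr] := rb.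
have Gb := real_bilinear_twirls X Z s2 rb.
have Db := real_bilinear_average (X j) (real_bilinear_insert (Z j) Gb).
have := sum_kraus_path_split x (f := kraus (X j) (Z j))
  (h := fun t y => ((-1) ^+ t.2 : R)%:C *: kraus (X j) (Z j) t y) eqs rb Db.
rewrite (eq_twirls (A := Z)) // => [|? ?]; last by rewrite addrC anti.
move=> /(_ (fun y z => sum_kraus_sign y z Gb (anti j))) E.
rewrite /correlation (eq_twirls s1 Db anti).
apply: (mulfI (expf_neq0 n (_ : 2 != 0 :> R))); first by rewrite pnatr_eq0.
rewrite -E mulr_sumr; apply: eq_bigr => a _.
rewrite -/(r _ _) zr !Psi_kraus_path zl zr eqs kraus_path_cat kraus_pathZ zr.
transitivity ((2 ^+ n * (amp ^+ n * amp ^+ n)) * ((-1) ^+ (a j).2 *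
  r (path s2 a (kraus (X j) (Z j) (a j) (path s1 a x)))
    (path s2 a (kraus (X j) (Z j) (a j) (path s1 a x))))); first by ring.
by rewrite amp_sqr mulfV ?mul1r // expf_neq0.
Qed.

(** The order Z, X of the swaps is already the one after which X is remeasured, and the flip on j''
    inserts [X j] by [sum_kraus_flip]. *)
Lemma sum_Psi_flip (s1 : seq 'I_n) j s2 x : enum 'I_n = s1 ++ j :: s2 ->
  \sum_a rdot (Psi X Z x a) (X j (Psi X Z x (flip_reg a j))) =
  correlation dot Z X s1 j s2 x.
Proof.
move=> eqs; pose r y z := rdot y (X j z).
have rb : real_bilinear r := real_bilinear_comp idfun (X j) (real_bilinear_rdot dot).
have [_ _ zl zr] := rb.
have Gb := real_bilinear_twirls Z X s2 rb.
have Db := real_bilinear_average (Z j) (real_bilinear_insert (X j) Gb).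
have := sum_kraus_path_split x (f := kraus (X j) (Z j))
  (h := fun t y => kraus (X j) (Z j) (t.1, rev_ord t.2) y) eqs rb Db.
move=> /(_ (fun y z => sum_kraus_flip (X j) (Z j) y z Gb)) E.
apply: (mulfI (expf_neq0 n (_ : 2 != 0 :> R))); first by rewrite pnatr_eq0.
rewrite /correlation -E mulr_sumr; apply: eq_bigr => a _.
have [j1 j2] : j \notin s1 /\ j \notin s2.
  have := enum_uniq 'I_n; rewrite eqs cat_uniq /= negb_or.
  by case/and3P=> _ /andP[-> _] /andP[-> _].
have flip_path s y : j \notin s -> path s (flip_reg a j) y = path s a y.
  move=> js; apply: eq_kraus_path => i si; rewrite set_reg_neq //.
  by apply: contraNneq js => <-.
rewrite -/(r _ _) !Psi_kraus_path zl zr eqs !kraus_path_cat !flip_path // set_reg_eq.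
by rewrite [amp ^+ n * _]mulrA amp_sqr mulrA mulfV ?mul1r // expf_neq0.
Qed.

End SwappedState.

(** * Exchanging qubits in abstract spaces *)

Section Exchange.
Variables (R : realType) (W : lmodType R[i]) (dot : {dot W for @conjC R[i]}).
Local Notation C := R[i].
Implicit Types (f g h : W) (A B S T U : {linear W -> W}).

(** Pairing with [h] turns vector identities into scalar ones, within reach of [ring] and
    [field]. *)
Lemma dot_ext f g : (forall h, dot f h = dot g h) -> f = g.
Proof. by move=> fg; apply: (@rdot_ext _ _ dot) => h; rewrite /rdot fg. Qed.

Lemma commuting_sym A B : commuting A B -> commuting B A.
Proof. by move=> AB f; rewrite AB. Qed.

Lemma commuting_comp A B T : commuting A T -> commuting B T -> commuting (A \o B) T.
Proof. by move=> AT BT f /=; rewrite BT AT. Qed.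

(** This is the square of [(1 + A + B - A B) / 2] at [u], for commuting reflections [A], [B] with
    [v], [w], [t] standing for [A u], [B u], [A B u]. *)
Lemma exchange_sum (u v w t : W) :
  2^-1 *: (2^-1 *: (u + v + w - t) + 2^-1 *: (v + u + t - w) +
    2^-1 *: (w + t + u - v) - 2^-1 *: (t + w + v - u)) = u.
Proof.
apply: dot_ext => h; rewrite !(linearZl_LR, linearDl, linearNl) /=.
by field.
Qed.

Section Qubits.
Variables X Z x z : {linear W -> W}.

(** The swap of two qubits that commute with each other. Since σ^y = i σ^x σ^z, the term with σ^y
    becomes [- X Z x z]. *)
Definition exchange : {linear W -> W} :=
  (2^-1 : C) \*: ((idfun \+ (X \o x)) \+ (Z \o z) \- ((X \o Z) \o (x \o z))).

Lemma exchangeE f :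
  exchange f = 2^-1 *: (f + X (x f) + Z (z f) - X (Z (x (z f)))).
Proof. by []. Qed.

Hypotheses (qXZ : is_qubit dot X Z) (qxz : is_qubit dot x z).
Hypotheses (cXx : commuting x X) (cXz : commuting z X).
Hypotheses (cZx : commuting x Z) (cZz : commuting z Z).

(** [X x] and [Z z] are reflections, and they commute because the two anti-commutation signs
    cancel. *)
Lemma exchange_reflection : is_reflection dot exchange.
Proof.
have [[sX XX] [sZ ZZ] XZ] := qXZ; have [[sx xx] [sz zz] xz] := qxz.
have ZX f : Z (X f) = - X (Z f) by apply/eqP; rewrite -addr_eq0 addrC XZ.
have zx f : z (x f) = - x (z f) by apply/eqP; rewrite -addr_eq0 addrC xz.
split=> [f g|f].
  have e : z (x (Z (X g))) = X (Z (x (z g))).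
    by rewrite ZX (linearN x) (linearN z) zx opprK cXz cZz cXx cZx.
  rewrite !exchangeE linearZl_LR linearZr_LR /=.
  rewrite !(linearDl, linearDr, linearNl, linearNr) /= fmorphV rmorph_nat.
  by rewrite !sX !sZ !sx !sz e cXx cZz.
pose A := X \o x : {linear W -> W}; pose B := Z \o z : {linear W -> W}.
have AA h : A (A h) = h by rewrite /= cXx XX xx.
have BB h : B (B h) = h by rewrite /= cZz ZZ zz.
have AB h : X (Z (x (z h))) = A (B h) by rewrite /= cZx.
have BA h : B (A h) = A (B h).
  by rewrite /= cXz ZX zx (linearN Z) (linearN X) opprK cZx.
have E h : exchange h = 2^-1 *: (h + A h + B h - A (B h)) by rewrite exchangeE AB.
rewrite !E !(linearZ_LR A) !(linearZ_LR B).
rewrite !(linearB A) !(linearB B) !(linearD A) !(linearD B).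
rewrite !(linearZ_LR A) !(linearB A) !(linearD A) !BA !AA !BB.
exact: exchange_sum.
Qed.

Lemma exchange_commuting T :
  commuting X T -> commuting Z T -> commuting x T -> commuting z T ->
  commuting exchange T.
Proof.
move=> XT ZT xT zT f; rewrite !exchangeE (linearZ_LR T) (linearB T) !(linearD T).
by rewrite !zT !xT !ZT !XT.
Qed.

End Qubits.

Section Composition.
Variables (I : Type) (S : I -> {linear W -> W}).

Fixpoint compose (s : seq I) : {linear W -> W} :=
  if s is j :: s' then (compose s' \o S j) else idfun.

Fixpoint compose_rev (s : seq I) : {linear W -> W} :=
  if s is j :: s' then (S j \o compose_rev s') else idfun.

Lemma composeE s f : compose s f = foldl (fun f j => S j f) f s.
Proof. by elim: s f => //= j s IH f; rewrite IH. Qed.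

Lemma compose_commuting s T :
  (forall j, commuting (S j) T) -> commuting (compose s) T.
Proof.
move=> ST; elim: s => [//|j s IH] /=; exact: commuting_comp IH (ST j).
Qed.

Lemma compose_rev_commuting s T :
  (forall j, commuting (S j) T) -> commuting (compose_rev s) T.
Proof.
move=> ST; elim: s => [//|j s IH] /=; exact: commuting_comp (ST j) IH.
Qed.

Hypothesis rS : forall j, is_reflection dot (S j).

Lemma composeK s f : compose_rev s (compose s f) = f.
Proof.
by elim: s f => //= j s IH f; rewrite IH; have [_ ->] := rS j.
Qed.

Lemma compose_revK s f : compose s (compose_rev s f) = f.
Proof.
by elim: s f => //= j s IH f; have [_ ->] := rS j; rewrite IH.
Qed.

Lemma compose_adjoint s f g : dot (compose s f) g = dot f (compose_rev s g).
Proof.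
by elim: s f g => //= j s IH f g; rewrite IH; have [-> _] := rS j.
Qed.

Lemma compose_rev_adjoint s f g : dot (compose_rev s f) g = dot f (compose s g).
Proof.
by elim: s f g => //= j s IH f g; have [-> _] := rS j; rewrite IH.
Qed.

Definition conjugate s T : {linear W -> W} := compose s \o (T \o compose_rev s).

Lemma conjugate_reflection s T :
  is_reflection dot T -> is_reflection dot (conjugate s T).
Proof.
case=> sT TT; split=> [f g|f] /=.
  by rewrite compose_adjoint sT compose_rev_adjoint.
by rewrite composeK TT compose_revK.
Qed.

Lemma conjugate_qubit s A B :
  is_qubit dot A B -> is_qubit dot (conjugate s A) (conjugate s B).
Proof.
case=> rA rB AB; split; [exact: conjugate_reflection..|move=> f /=].
by rewrite !composeK -linearD AB linear0.
Qed.

Lemma conjugate_commuting s A B :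
  commuting A B -> commuting (conjugate s A) (conjugate s B).
Proof. by move=> AB f /=; rewrite !composeK AB. Qed.

Lemma conjugate_commutingr s A T : (forall j, commuting (S j) T) ->
  commuting A T -> commuting (conjugate s A) T.
Proof.
move=> ST AT; apply: commuting_comp; first exact: compose_commuting.
by apply: commuting_comp => //; exact: compose_rev_commuting.
Qed.

(* An operator that is mirrored by [T] on [f] has its conjugate mirrored by [T]
   on the conjugated vector, as [T] commutes with the conjugation. *)
Lemma conjugate_mirror s A T f : (forall j, commuting (S j) T) ->
  A f = T f -> conjugate s A (compose s f) = T (compose s f).
Proof. by move=> ST Af /=; rewrite composeK Af compose_commuting. Qed.

End Composition.

End Exchange.

(** * Replacing the factors of a product one by one *)

Section Telescoping.
Variables (R : realType) (W : lmodType R[i]) (dot : {dot W for @conjC R[i]}).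
Implicit Types (f g : W).

Lemma foldr_linear_sub (I : Type) (U : I -> W -> W) (s : seq I) f g :
  (forall l u v, U l (u - v) = U l u - U l v) ->
  foldr U f s - foldr U g s = foldr U (f - g) s.
Proof. by move=> linU; elim: s => //= l s <-; rewrite linU. Qed.

Lemma hnorm_foldr (I : Type) (U : I -> W -> W) (s : seq I) f :
  (forall l u, hnorm dot (U l u) <= hnorm dot u) ->
  hnorm dot (foldr U f s) <= hnorm dot f.
Proof. by move=> cU; elim: s => //= l s; apply: le_trans. Qed.

Lemma foldr_commute (I : Type) (U : I -> W -> W) (s : seq I) (T : W -> W) f :
  (forall l u, U l (T u) = T (U l u)) -> foldr U (T f) s = T (foldr U f s).
Proof. by move=> UT; elim: s => //= l s ->. Qed.

(* The operators of the sequence are replaced one at a time, starting with the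
   one that acts first: [V l] agrees with [Uh l] on [f], is close to [U l] there,
   and commutes past all the others. *)
Lemma hnorm_telescope (I : Type) (U Uh V : I -> W -> W) (s : seq I) f (e : R) :
  (forall l u v, U l (u - v) = U l u - U l v) ->
  (forall l u v, V l (u - v) = V l u - V l v) ->
  (forall l u, hnorm dot (U l u) <= hnorm dot u) ->
  (forall l u, hnorm dot (V l u) <= hnorm dot u) ->
  (forall l m u, U l (V m u) = V m (U l u)) ->
  (forall l m u, Uh l (V m u) = V m (Uh l u)) ->
  (forall l, Uh l f = V l f) ->
  (forall l, hnorm dot (U l f - V l f) <= e) ->
  hnorm dot (foldr U f s - foldr Uh f s) <= (size s)%:R * e.
Proof.
move=> linU linV cU cV UV UhV UhfV close.
elim/last_ind: s => [|s l IH]; first by rewrite subrr mul0r hnorm0.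
rewrite !foldr_rcons UhfV (foldr_commute _ _ (fun k => UhV k l)).
(* The first summand is the new error, contracted by the other [U]; the second is the old
   difference, contracted by [V l]. *)
have -> : foldr U (U l f) s - V l (foldr Uh f s) =
    foldr U (U l f - V l f) s + V l (foldr U f s - foldr Uh f s).
  rewrite -foldr_linear_sub // (foldr_commute _ _ (fun k => UV k l)) linV.
  by rewrite addrA subrK.
apply: le_trans (hnorm_triangle _ _ _) _.
rewrite size_rcons -natr1 mulrDl mul1r addrC lerD //.
  exact: le_trans (cV _ _) IH.
exact: le_trans (hnorm_foldr _ _ _) (close l).
Qed.

End Telescoping.

(** * Contractions acting on a qubit *)

Section Contraction.
Variables (R : realType).
Local Notation C := R[i].

(* The matrix of [a + b X + c Z + d (i X Z)] in a basis [e], [X e] with [Z e = e]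
   is [[a + c, b - i d], [b + i d, a - c]]. *)
Definition matrix_contraction (a b c d : C) : Prop := forall u v : C,
  `|(a + c) * u + (b - 'i%C * d) * v| ^+ 2 +
  `|(b + 'i%C * d) * u + (a - c) * v| ^+ 2 <= `|u| ^+ 2 + `|v| ^+ 2.

Lemma conj_i : conjC ('i%C : C) = - 'i%C.
Proof. by apply/eqP; rewrite eq_complex /= oppr0 !eqxx. Qed.

(** Entrywise conjugation preserves contractions. It also conjugates i, which amounts to negating
    [d]. *)
Lemma matrix_contraction_conj a b c d :
  matrix_contraction (conjC a) (conjC b) (conjC c) (conjC d) ->
  matrix_contraction a b c (- d).
Proof.
move=> m u v; have := m (conjC u) (conjC v); rewrite !norm_conjC.
rewrite -(norm_conjC (_ + _ * v)) -(norm_conjC (_ + (a - c) * v)).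
rewrite !(rmorphD, rmorphB, rmorphM, rmorphN) /= conj_i.
by rewrite !(mulNr, mulrN, opprK).
Qed.

(** The columns of a contraction have norm at most 1, hence so do the entries; [b], [c] and [i d]
    are half sums of entries up to sign. *)
Lemma matrix_contraction_le1 a b c d : matrix_contraction a b c d ->
  [/\ `|b| <= 1, `|c| <= 1 & `|d| <= 1].
Proof.
move=> m; have := m 1 0; have := m 0 1.
rewrite !(mulr0, mulr1, add0r, addr0, normr0, normr1, expr0n, expr1n) /= => m1 m0.
have le1 (x y : C) : `|x| ^+ 2 + `|y| ^+ 2 <= 1 -> `|x| <= 1 /\ `|y| <= 1.
  move=> xy; split; rewrite -(@expr_le1 _ 2) //; apply: le_trans xy.
    by rewrite lerDl exprn_ge0.
  by rewrite lerDr exprn_ge0.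
have [h01 h11] := le1 _ _ m1; have [h00 h10] := le1 _ _ m0.
have half (x y z : C) : `|x| <= 1 -> `|y| <= 1 -> 2 * z = x + y -> `|z| <= 1.
  move=> x1 y1 e; rewrite -(ler_pM2l (_ : 0 < 2 :> C)) ?ltr0n //.
  rewrite -{1}[2]normr_nat -normrM e mulr1.
  by apply: le_trans (ler_normD _ _) _; rewrite -[2]/(1 + 1) lerD.
split.
- by apply: half h01 h10 _; ring.
- apply: half h00 (_ : `|c - a| <= 1) _; last by ring.
  by rewrite distrC.
- have : `|'i%C * d| <= 1.
    apply: half h10 (_ : `|'i%C * d - b| <= 1) _; last by ring.
    by rewrite distrC.
  rewrite normrM.
  have -> : `|'i%C| = 1 :> C by rewrite normc_def /= expr0n expr1n /= add0r sqrtr1.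
  by rewrite mul1r.
Qed.

Section QubitOperator.
Variables (V : lmodType C) (dot : {dot V for @conjC C}).
Implicit Types (X Z A B : {linear V -> V}) (x y : V) (a b c d u : C).

Lemma qubit_opD X Z a b c d x y :
  qubit_op X Z a b c d (x + y) = qubit_op X Z a b c d x + qubit_op X Z a b c d y.
Proof.
rewrite /qubit_op (linearD Z) !(linearD X); apply: (dot_ext (dot := dot)) => h.
by rewrite !(linearDl, linearZl_LR) /=; ring.
Qed.

Lemma qubit_opZ X Z a b c d u x :
  qubit_op X Z a b c d (u *: x) = u *: qubit_op X Z a b c d x.
Proof.
rewrite /qubit_op (linearZ_LR Z) !(linearZ_LR X); apply: (dot_ext (dot := dot)) => h.
by rewrite !(linearDl, linearZl_LR) /=; ring.
Qed.

Lemma qubit_opB X Z a b c d x y :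
  qubit_op X Z a b c d (x - y) = qubit_op X Z a b c d x - qubit_op X Z a b c d y.
Proof. by rewrite qubit_opD -[- y]scaleN1r qubit_opZ scaleN1r. Qed.

Lemma qubit_op_commuting X Z a b c d (T : V -> V) :
  {morph T : x y / x + y} -> (forall u, {morph T : x / u *: x}) ->
  commuting X T -> commuting Z T -> commuting (qubit_op X Z a b c d) T.
Proof. by move=> TD TZ XT ZT x; rewrite /qubit_op !(TD, TZ) !ZT !XT. Qed.

Lemma qubit_op_commuting2 X Z A B a b c d a' b' c' d' :
  [/\ commuting X A, commuting X B, commuting Z A & commuting Z B] ->
  commuting (qubit_op X Z a b c d) (qubit_op A B a' b' c' d').
Proof.
move=> [XA XB ZA ZB].
have comm (Y : {linear V -> V}) : commuting Y A -> commuting Y B ->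
    commuting Y (qubit_op A B a' b' c' d').
  move=> YA YB x; apply/esym.
  apply: qubit_op_commuting => [y z|u y|y|y].
  - exact: linearD.
  - exact: linearZ_LR.
  - exact/esym/YA.
  - exact/esym/YB.
apply: qubit_op_commuting => [x y|u x||]; [exact: qubit_opD|exact: qubit_opZ|..].
  exact: comm.
exact: comm.
Qed.

End QubitOperator.

Section Qubit.
Variables (V : lmodType C) (dot : {dot V for @conjC C}).
Variables (X Z : {linear V -> V}).
Hypothesis qXZ : is_qubit dot X Z.
Implicit Types x y f : V.

Let ZX x : Z (X x) = - X (Z x).
Proof. by case: qXZ => _ _ h; apply/eqP; rewrite -addr_eq0 addrC h. Qed.

Lemma qubit_opE a b c d e : Z e = e ->
  qubit_op X Z a b c d e = (a + c) *: e + X ((b + 'i%C * d) *: e).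
Proof.
move=> Ze; rewrite /qubit_op Ze (linearZ_LR X) /= !scalerDl scalerA [d * _]mulrC.
by rewrite [_ + c *: e]addrAC -!addrA.
Qed.

Lemma qubit_op_flipE a b c d e : Z e = e ->
  qubit_op X Z a b c d (X e) = (b - 'i%C * d) *: e + X ((a - c) *: e).
Proof.
move=> Ze; have [[_ XX] _ _] := qXZ.
rewrite /qubit_op XX ZX Ze (linearN X) XX (linearZ_LR X) /= !scalerBl !scalerN.
by rewrite scalerA [d * _]mulrC [_ - c *: X e]addrAC -[LHS]addrA addrC.
Qed.

(** [i X Z] is Hermitian: its adjoint is [- i Z X], which equals [i X Z]. *)
Lemma dot_qubit_op a b c d x y :
  dot (qubit_op X Z a b c d x) y =
  dot x (qubit_op X Z (conjC a) (conjC b) (conjC c) (conjC d) y).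
Proof.
have [[sX _] [sZ _] _] := qXZ; rewrite /qubit_op.
rewrite !(linearDl, linearDr, linearZl_LR, linearZr_LR) /= !conjCK conj_i.
by rewrite !(sX, sZ) ZX linearNr; ring.
Qed.

(** [X y] is in the eigenspace of [Z] for -1, which is orthogonal to that for +1. *)
Lemma dot_eigen_flip x y : Z x = x -> Z y = y -> dot x (X y) = 0.
Proof.
move=> Zx Zy; have [_ [sZ _] _] := qXZ.
have : dot x (X y) = - dot x (X y).
  by rewrite -{1}Zx sZ ZX Zy linearNr.
by move/eqP; rewrite -addr_eq0 -mulr2n mulrn_eq0 /= => /eqP.
Qed.

Lemma dnorm_eigen x y : Z x = x -> Z y = y ->
  dot (x + X y) (x + X y) = dot x x + dot y y.
Proof.
move=> Zx Zy; have [[sX XX] _ _] := qXZ.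
rewrite hnormDd; last exact: dot_eigen_flip.
by congr (_ + _); have := sX y (X y); rewrite XX.
Qed.

(** Either [x + Z x] is such a vector, or [Z x = - x] and [X x] is one. *)
Lemma exists_eigen x : x != 0 -> exists2 e, e != 0 & Z e = e.
Proof.
move=> x0; have [[_ XX] [_ ZZ] _] := qXZ.
have [Zx|Zx] := eqVneq (x + Z x) 0; last first.
  by exists (x + Z x); rewrite // linearD ZZ addrC.
exists (X x); last first.
  rewrite ZX -linearN; congr (X _); apply/eqP.
  by rewrite eq_sym -addr_eq0 Zx.
by apply: contraNneq x0 => h; rewrite -(XX x) h linear0.
Qed.

(** On the vectors [u e + v X e] the operator acts as its matrix, and norms are those of [(u, v)]
    scaled by the norm of [e]. *)
Lemma contraction_matrix a b c d x : x != 0 ->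
  (forall f, dot (qubit_op X Z a b c d f) (qubit_op X Z a b c d f) <= dot f f) ->
  matrix_contraction a b c d.
Proof.
move=> /exists_eigen[e e0 Ze] h u v.
have Zs (w : C) : Z (w *: e) = w *: e by rewrite (linearZ_LR Z) /= Ze.
have := h (u *: e + X (v *: e)).
have -> : qubit_op X Z a b c d (u *: e + X (v *: e)) =
    ((a + c) * u + (b - 'i%C * d) * v) *: e +
    X (((b + 'i%C * d) * u + (a - c) * v) *: e).
  rewrite !(linearZ_LR X) /= (qubit_opD dot) !(qubit_opZ dot).
  rewrite qubit_opE // qubit_op_flipE //.
  rewrite !(linearZ_LR X); apply: (dot_ext (dot := dot)) => g.
  by rewrite !(linearDl, linearZl_LR) /=; ring.
by rewrite !dnorm_eigen // !dnormZ -!mulrDl ler_pM2r ?dnorm_gt0.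
Qed.

(** Write [x = p + X q] with [p], [q] fixed by [Z], and [q = l p + r] with [r] orthogonal to [p].
    The matrix then acts separately on [(1, l)], weighted by [p], and on [(0, 1)], weighted by
    [r]. *)
Lemma matrix_contractionP a b c d x : matrix_contraction a b c d ->
  dot (qubit_op X Z a b c d x) (qubit_op X Z a b c d x) <= dot x x.
Proof.
move=> m; have [[_ XX] [_ ZZ] _] := qXZ.
pose p := 2^-1 *: (x + Z x); pose q := 2^-1 *: X (x - Z x).
have Zp : Z p = p by rewrite (linearZ_LR Z) /= (linearD Z) ZZ addrC.
have Zq : Z q = q.
  by rewrite (linearZ_LR Z) /= ZX -(linearN X) (linearB Z) ZZ opprB.
have ex : x = p + X q.
  rewrite (linearZ_LR X) /= XX -scalerDr addrACA subrr addr0 -mulr2n.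
  rewrite -(scaler_nat 2 x) scalerA.
  by rewrite mulVf ?pnatr_eq0 // scale1r.
clearbody p q; pose l := dot q p / dot p p; pose r := q - l *: p.
have pr : dot p r = 0.
  have rp : dot r p = 0.
    rewrite linearBl linearZl_LR /=; have [p0|p0] := eqVneq p 0.
      by rewrite p0 !linear0r mulr0 subr0.
    by rewrite /l divfK ?subrr // dnorm_eq0.
  have -> : dot p r = conjC (dot r p) by rewrite hermC expr0 mul1r.
  by rewrite rp conjC0.
have eq : q = l *: p + r by rewrite addrC subrK.
clearbody l r.
have dsum (s t : C) : dot (s *: p + t *: q) (s *: p + t *: q) =
    `|s + t * l| ^+ 2 * dot p p + `|t| ^+ 2 * dot r r.
  rewrite eq scalerDr scalerA addrA -scalerDl hnormDd.
    by congr (_ + _); exact: dnormZ.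
  by rewrite linearZl_LR linearZr_LR /= pr !mulr0.
have -> : qubit_op X Z a b c d x =
    ((a + c) *: p + (b - 'i%C * d) *: q) + X ((b + 'i%C * d) *: p + (a - c) *: q).
  rewrite ex (qubit_opD dot) qubit_opE // qubit_op_flipE // addrACA -linearD //.
have Zs (s t : C) : Z (s *: p + t *: q) = s *: p + t *: q.
  by rewrite (linearD Z) !(linearZ_LR Z) Zp Zq.
rewrite dnorm_eigen // [in leRHS]ex dnorm_eigen // !dsum.
have -> : dot q q = `|l| ^+ 2 * dot p p + dot r r.
  rewrite eq hnormDd; first by congr (_ + _); exact: dnormZ.
  by rewrite linearZl_LR /= pr mulr0.
rewrite addrACA -!mulrDl addrA -[X in _ <= X + _ + _]mul1r -mulrDl.
rewrite -[X in _ <= _ + X]mul1r.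
have := m 1 l; have := m 0 1.
rewrite !(mulr0, mulr1, add0r, addr0, normr0, normr1, expr0n, expr1n) /= => m1 ml.
by apply: lerD; apply: ler_wpM2r; rewrite ?dnorm_ge0.
Qed.

End Qubit.

Section Norms.
Variables (V : lmodType C) (dot : {dot V for @conjC C}).
Implicit Types x y f : V.

Lemma dot_le_hnorm x y : (dot x x <= dot y y) = (hnorm dot x <= hnorm dot y).
Proof.
rewrite !dotE lecR -!sqr_hnorm ler_pXn2r // nnegrE; exact: hnorm_nneg.
Qed.

Lemma opnorm_le1 (A : V -> V) x :
  (forall (c : C) y, A (c *: y) = c *: A y) -> (opnorm dot A <= 1)%E ->
  hnorm dot (A x) <= hnorm dot x.
Proof.
move=> lA A1; have [x0|x0] := eqVneq (hnorm dot x) 0.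
  by rewrite (hnorm_eq0P x0) -(scale0r 0) lA !scale0r.
have xp : 0 < hnorm dot x by rewrite lt_neqAle eq_sym x0 hnorm_nneg.
pose y := ((hnorm dot x)^-1)%:C *: x.
have y1 : hnorm dot y = 1 by rewrite hnormZr ?invr_ge0 ?hnorm_nneg // mulVf.
have : ((hnorm dot (A y))%:E <= 1)%E.
  apply: le_trans A1; apply: ereal_sup_ubound; exists y => //=.
  by rewrite y1.
rewrite lee_fin /y lA hnormZr ?invr_ge0 ?hnorm_nneg //.
by rewrite ler_pdivrMl // mulr1.
Qed.

(** By Cauchy-Schwarz, [|B x|^2 = <A (B x), x> <= |B x| |x|]. *)
Lemma adjoint_contraction (A B : V -> V) :
  (forall x y, dot (A x) y = dot x (B y)) ->
  (forall x, hnorm dot (A x) <= hnorm dot x) ->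
  forall x, hnorm dot (B x) <= hnorm dot x.
Proof.
move=> AB cA x; have [->|B0] := eqVneq (hnorm dot (B x)) 0; first exact: hnorm_nneg.
have Bp : 0 < hnorm dot (B x) by rewrite lt_neqAle eq_sym B0 hnorm_nneg.
rewrite -(ler_pM2l Bp) -expr2 sqr_hnorm {1}/rdot -AB -/(rdot _ _ _).
apply: le_trans (rdot_le _ _ _) _; rewrite ler_wpM2r ?hnorm_nneg //.
Qed.

End Norms.

(* The transposed matrix (with [- d] for [d]) is a contraction as it is the
   conjugate of the adjoint. *)
Lemma opnorm_matrix_contraction (V : lmodType C) (dot : {dot V for @conjC C})
    (X Z : {linear V -> V}) (x : V) (a b c d : C) :
  is_qubit dot X Z -> x != 0 ->
  (forall y, hnorm dot (qubit_op X Z a b c d y) <= hnorm dot y) ->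
  matrix_contraction a b c d /\ matrix_contraction a b c (- d).
Proof.
move=> qXZ x0 cU; split.
  by apply: (contraction_matrix qXZ x0) => y; rewrite dot_le_hnorm.
apply: matrix_contraction_conj; apply: (contraction_matrix qXZ x0) => y.
rewrite dot_le_hnorm; apply: adjoint_contraction cU _ => u v.
exact: dot_qubit_op.
Qed.

End Contraction.

(** * Operators on the registers *)

Section RegisterOperators.
Variables (R : realType) (V : lmodType R[i]) (dot : {dot V for @conjC R[i]}).
Variable n : nat.
Local Notation C := R[i].
Local Notation W := (with_registers V n).
Local Notation Dot := (sumdot dot (T:=registers n)).
Implicit Types (f g : W) (a : registers n) (A B : {linear V -> V}).
Implicit Types (h : registers n -> registers n) (e : registers n -> bool).

Definition permute_op h f : W := [ffun a : registers n => f (h a)].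
Definition sign_op e f : W := [ffun a : registers n => (-1) ^+ e a *: f a].

Lemma permute_op_linear h : linear (permute_op h).
Proof. by move=> c f g; apply/ffunP => a; rewrite !ffunE. Qed.

Lemma sign_op_linear e : linear (sign_op e).
Proof.
move=> c f g; apply/ffunP => a; rewrite !ffunE scalerDr !scalerA.
by rewrite [_ * c]mulrC.
Qed.

Lemma extend_op_linear A : linear (@extend_op R V n A).
Proof. by move=> c f g; apply/ffunP => a; rewrite !ffunE linearP. Qed.

HB.instance Definition _ h :=
  GRing.isLinear.Build C W W _ (permute_op h) (permute_op_linear h).
HB.instance Definition _ e :=
  GRing.isLinear.Build C W W _ (sign_op e) (sign_op_linear e).
HB.instance Definition _ A :=
  GRing.isLinear.Build C W W _ (@extend_op R V n A) (extend_op_linear A).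

Lemma permute_op_reflection h : involutive h -> is_reflection Dot (permute_op h).
Proof.
move=> hK; split=> [f g|f]; last by apply/ffunP => a; rewrite !ffunE hK.
rewrite /sumdot [LHS](reindex_inj (inv_inj hK)).
by apply: eq_bigr => a _; rewrite !ffunE hK.
Qed.

Lemma sign_op_reflection e : is_reflection Dot (sign_op e).
Proof.
split=> [f g|f].
  apply: eq_bigr => a _; rewrite !ffunE linearZl_LR linearZr_LR /=.
  by rewrite rmorph_sign.
by apply/ffunP => a; rewrite !ffunE scalerA -signr_addb addbb scale1r.
Qed.

Lemma extend_op_reflection A :
  is_reflection dot A -> is_reflection Dot (@extend_op R V n A).
Proof.
case=> sA AA; split=> [f g|f]; last by apply/ffunP => a; rewrite !ffunE AA.
by apply: eq_bigr => a _; rewrite !ffunE sA.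
Qed.

Lemma permute_op_commuting h h' : (forall a, h (h' a) = h' (h a)) ->
  commuting (permute_op h) (permute_op h').
Proof. by move=> hh f; apply/ffunP => a; rewrite !ffunE hh. Qed.

Lemma sign_op_commuting e e' : commuting (sign_op e) (sign_op e').
Proof. by move=> f; apply/ffunP => a; rewrite !ffunE !scalerA mulrC. Qed.

Lemma permute_sign_commuting h e : (forall a, e (h a) = e a) ->
  commuting (permute_op h) (sign_op e).
Proof. by move=> he f; apply/ffunP => a; rewrite !ffunE he. Qed.

Lemma permute_sign_anti h e f : (forall a, e (h a) = ~~ e a) ->
  permute_op h (sign_op e f) + sign_op e (permute_op h f) = 0.
Proof.
by move=> he; apply/ffunP => a; rewrite !ffunE he signrN scaleNr addNr.
Qed.

Lemma extend_permute_commuting A h :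
  commuting (@extend_op R V n A) (permute_op h).
Proof. by move=> f; apply/ffunP => a; rewrite !ffunE. Qed.

Lemma extend_sign_commuting A e : commuting (@extend_op R V n A) (sign_op e).
Proof. by move=> f; apply/ffunP => a; rewrite !ffunE linearZ_LR. Qed.

Lemma extend_op_qubit A B : is_qubit dot A B ->
  is_qubit Dot (@extend_op R V n A) (@extend_op R V n B).
Proof.
case=> rA rB AB; split; [exact: extend_op_reflection..|move=> f].
by apply/ffunP => a; rewrite !ffunE AB.
Qed.

Lemma extend_qubit_op A B (a b c d : C) f :
  extend_op (qubit_op A B a b c d) f =
  qubit_op (@extend_op R V n A) (@extend_op R V n B) a b c d f.
Proof. by apply/ffunP => r; rewrite !ffunE. Qed.

Implicit Types j : 'I_n.

Definition flip_prime a j := set_reg a j (rev_ord (a j).1, (a j).2).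

(** These four are the Pauli operators σ^x and σ^z on the registers j' and j''. *)
Definition prime_x j : {linear W -> W} := permute_op (flip_prime^~ j).
Definition prime_z j : {linear W -> W} := sign_op (fun a => (a j).1 != ord0).
Definition second_x j : {linear W -> W} := permute_op ((@flip_reg n)^~ j).
Definition second_z j : {linear W -> W} := sign_op (fun a => (a j).2 != ord0).

Lemma rev_bit_neq0 (t : 'I_2) : (rev_ord t != ord0) = ~~ (t != ord0).
Proof. by case: (bitP t) => ->; rewrite ?rev_bit0 ?rev_bit1. Qed.

Lemma flip_primeE a j i :
  flip_prime a j i = if i == j then (rev_ord (a i).1, (a i).2) else a i.
Proof. by rewrite ffunE; case: eqP => // ->. Qed.

Lemma flip_regE a j i :
  flip_reg a j i = if i == j then ((a i).1, rev_ord (a i).2) else a i.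
Proof. by rewrite ffunE; case: eqP => // ->. Qed.

Lemma flip_primeK j : involutive (flip_prime^~ j).
Proof.
move=> a; apply/ffunP => i; rewrite !flip_primeE; case: eqP => // _.
by rewrite /= rev_ordK; case: (a i).
Qed.

Lemma flip_regK j : involutive ((@flip_reg n)^~ j).
Proof.
move=> a; apply/ffunP => i; rewrite !flip_regE; case: eqP => // _.
by rewrite /= rev_ordK; case: (a i).
Qed.

Lemma prime_qubit j : is_qubit Dot (prime_x j) (prime_z j).
Proof.
split; [exact/permute_op_reflection/flip_primeK|exact: sign_op_reflection|].
by move=> f; apply: permute_sign_anti => a; rewrite flip_primeE eqxx rev_bit_neq0.
Qed.

Lemma second_qubit j : is_qubit Dot (second_x j) (second_z j).
Proof.
split; [exact/permute_op_reflection/flip_regK|exact: sign_op_reflection|].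
by move=> f; apply: permute_sign_anti => a; rewrite flip_regE eqxx rev_bit_neq0.
Qed.

Lemma prime_independent : independent_qubits prime_x prime_z.
Proof.
move=> i j ij; have ji : j != i by rewrite eq_sym.
split; [|apply: permute_sign_commuting => a|
  apply: commuting_sym; apply: permute_sign_commuting => a|exact: sign_op_commuting].
- apply: permute_op_commuting => a; apply/ffunP => k.
  rewrite !flip_primeE; case: (eqVneq k i) => [->|//].
  by rewrite (negPf ij).
- by rewrite flip_primeE (negPf ji).
- by rewrite flip_primeE (negPf ij).
Qed.

Lemma prime_second_commuting i j :
  [/\ commuting (prime_x i) (second_x j), commuting (prime_x i) (second_z j),
      commuting (prime_z i) (second_x j) & commuting (prime_z i) (second_z j)].
Proof.
split; [|apply: permute_sign_commuting => a|
  apply: commuting_sym; apply: permute_sign_commuting => a|exact: sign_op_commuting].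
- apply: permute_op_commuting => a; apply/ffunP => k.
  by rewrite !(flip_primeE, flip_regE); case: (k == i); case: (k == j).
- by rewrite flip_primeE; case: (j == i).
- by rewrite flip_regE; case: (i == j).
Qed.

Lemma swapE (X Z : 'I_n -> {linear V -> V}) j f :
  swap X Z j f = exchange (@extend_op R V n (X j)) (@extend_op R V n (Z j))
    (prime_x j) (prime_z j) f.
Proof.
rewrite exchangeE; apply/ffunP => a.
have fE t : f (set_prime a j t) = f (set_reg a j (t, (a j).2)).
  by congr (f _); apply/ffunP => i; rewrite !ffunE; case: eqP => // ->.
have fa : f a = f (set_reg a j ((a j).1, (a j).2)).
  by congr (f _); apply/ffunP => i; rewrite !ffunE; case: eqP => // ->; case: (a j).
rewrite /swap /tensor_op !ffunE !sum_bit !fE /= !mxE fa /flip_prime eqxx.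
case: (a j) => t u /=; case: (bitP t) => -> /=; rewrite ?(rev_bit0, rev_bit1) /=;
  rewrite ?(scale0r, scale1r, add0r, addr0, expr0, expr1);
  rewrite ?(linearZ_LR (Z j)) ?(linearZ_LR (X j)) /= ?scaleN1r ?scale1r ?scalerA;
  rewrite ?mulrN -expr2 sqr_i ?opprK ?scaleN1r ?scale1r;
  rewrite ?(linearN (Z j)) ?(linearN (X j)).
all: by rewrite eqxx /= ?(expr0, expr1) ?scaleN1r ?scale1r ?opprK.
Qed.

Lemma EPR_flip (t u : 'I_2) : EPR R (rev_ord t, u) = EPR R (t, rev_ord u).
Proof.
rewrite /EPR /=; congr (_ * _%:R).
by case: (bitP t) => ->; case: (bitP u) => ->; rewrite !(rev_bit0, rev_bit1).
Qed.

Lemma Psi0_mirror_x j x : prime_x j (Psi0 n x) = second_x j (Psi0 n x).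
Proof.
apply/ffunP => a; rewrite !ffunE; congr (_ *: _); apply: eq_bigr => i _.
rewrite flip_primeE flip_regE; case: eqP => // _; exact: EPR_flip.
Qed.

(** The amplitude vanishes unless the bits of j' and j'' agree, and then the two signs agree as
    well. *)
Lemma Psi0_mirror_z j x : prime_z j (Psi0 n x) = second_z j (Psi0 n x).
Proof.
apply/ffunP => a; rewrite !ffunE; have [->//|ne] := eqVneq (a j).1 (a j).2.
by rewrite (bigD1 j) //= /EPR (negPf ne) mulr0 mul0r scale0r !scaler0.
Qed.

End RegisterOperators.

(** * The independent qubits and their distance from the given ones *)

Section Untangling.
Variables (R : realType) (V : lmodType R[i]) (dot : {dot V for @conjC R[i]}).
Variables (n : nat) (psi : V) (X Z : 'I_n -> {linear V -> V}).
Hypothesis psi1 : hnorm dot psi = 1.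
Hypothesis qXZ : forall j, is_qubit dot (X j) (Z j).
Local Notation C := R[i].
Local Notation W := (with_registers V n).
Local Notation Dot := (sumdot dot (T:=registers n)).
Local Notation ext := (@extend_op R V n).
Local Notation PsiXZ := (Psi X Z psi).
Implicit Types (j : 'I_n) (f g : W).

Let S j : {linear W -> W} :=
  exchange (ext (X j)) (ext (Z j)) (prime_x V j) (prime_z V j).

Definition hat_x j : {linear W -> W} := conjugate S (enum 'I_n) (prime_x V j).
Definition hat_z j : {linear W -> W} := conjugate S (enum 'I_n) (prime_z V j).

Let anti j x : X j (Z j x) + Z j (X j x) = 0.
Proof. by case: (qXZ j). Qed.

Let S_reflection j : is_reflection Dot (S j).
Proof.
apply: exchange_reflection; [exact: extend_op_qubit|exact: prime_qubit|..].
- exact/commuting_sym/extend_permute_commuting.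
- exact/commuting_sym/extend_sign_commuting.
- exact/commuting_sym/extend_permute_commuting.
- exact/commuting_sym/extend_sign_commuting.
Qed.

Let S_commuting_x i j : commuting (S i) (second_x V j).
Proof.
have [xx _ zx _] := prime_second_commuting V i j.
by apply: exchange_commuting => //; exact: extend_permute_commuting.
Qed.

Let S_commuting_z i j : commuting (S i) (second_z V j).
Proof.
have [_ xz _ zz] := prime_second_commuting V i j.
by apply: exchange_commuting => //; exact: extend_sign_commuting.
Qed.

Lemma PsiE : PsiXZ = compose S (enum 'I_n) (Psi0 n psi).
Proof.
rewrite composeE /Psi; congr foldl; apply/funext => f; apply/funext => j.
exact: swapE.
Qed.

Lemma hat_qubit j : is_qubit Dot (hat_x j) (hat_z j).
Proof. by apply: conjugate_qubit; [exact: S_reflection|exact: prime_qubit]. Qed.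

Lemma hat_independent : independent_qubits hat_x hat_z.
Proof.
move=> i j /(prime_independent V)[xx xz zx zz].
by split; apply: conjugate_commuting S_reflection _ _ _ _.
Qed.

Lemma hat_commuting i j :
  [/\ commuting (hat_x i) (second_x V j), commuting (hat_x i) (second_z V j),
      commuting (hat_z i) (second_x V j) & commuting (hat_z i) (second_z V j)].
Proof.
by have [xx xz zx zz] := prime_second_commuting V i j;
  split; apply: conjugate_commutingr.
Qed.

Lemma hat_mirror_x j : hat_x j PsiXZ = second_x V j PsiXZ.
Proof. by rewrite PsiE; apply: (conjugate_mirror S_reflection) (Psi0_mirror_x _ _). Qed.

Lemma hat_mirror_z j : hat_z j PsiXZ = second_z V j PsiXZ.
Proof. by rewrite PsiE; apply: (conjugate_mirror S_reflection) (Psi0_mirror_z _ _). Qed.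

Lemma rdot_sumdot f g : rdot Dot f g = \sum_a rdot dot (f a) (g a).
Proof. by rewrite /rdot /sumdot raddf_sum. Qed.

Lemma rdot_Psi : rdot Dot PsiXZ PsiXZ = 1.
Proof.
rewrite rdot_sumdot (sum_Psi _ _ _ (real_bilinear_rdot dot)) twirls_rdot.
- by rewrite -sqr_hnorm psi1 expr1n.
- by move=> j; case: (qXZ j).
- by move=> j; case: (qXZ j).
Qed.

Definition mirror_err_x j := hnorm Dot (ext (X j) PsiXZ - second_x V j PsiXZ).
Definition mirror_err_z j := hnorm Dot (ext (Z j) PsiXZ - second_z V j PsiXZ).

Let before j := take j (enum 'I_n).
Let after j := drop j.+1 (enum 'I_n).

Let enum_split j : enum 'I_n = before j ++ j :: after j.
Proof.
by rewrite -[LHS](cat_take_drop j) (drop_nth j) ?size_enum_ord // nth_ord_enum.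
Qed.

(** Both vectors are unit vectors, so the squared distance is 2 minus twice their real inner
    product. *)
Lemma sqr_mirror_err_x j : mirror_err_x j ^+ 2 =
  2 - 2 * correlation dot Z X (before j) j (after j) psi.
Proof.
have [rX _ _] := qXZ j; have [rx _ _] := second_qubit dot j.
rewrite /mirror_err_x sqr_hnormB (reflection_rdot _ _ rx).
rewrite (reflection_rdot _ _ (extend_op_reflection n rX)) rdot_Psi; congr (_ - _ * _).
rewrite -(sum_Psi_flip dot X Z psi (enum_split j)) rdot_sumdot; apply: eq_bigr => a _.
by rewrite !ffunE; case: rX => sX _; rewrite /rdot sX.
Qed.

Lemma sqr_mirror_err_z j : mirror_err_z j ^+ 2 =
  2 - 2 * correlation dot X Z (before j) j (after j) psi.
Proof.
have [_ rZ _] := qXZ j; have [_ rz _] := second_qubit dot j.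
rewrite /mirror_err_z sqr_hnormB (reflection_rdot _ _ rz).
rewrite (reflection_rdot _ _ (extend_op_reflection n rZ)) rdot_Psi; congr (_ - _ * _).
rewrite -(sum_Psi_sign dot anti psi (enum_split j)) rdot_sumdot; apply: eq_bigr => a _.
rewrite !ffunE; case: rZ => sZ _; rewrite /rdot sZ.
congr (complex.Re (dot _ (Z j (_ *: _)))).
by case: (bitP (a j).2) => ->; rewrite /= ?expr0 ?expr1 ?rmorphN rmorph1.
Qed.

(** With [S] the sum of all correlations, the acceptance probability is [1/2 + S / (4 n)] and the
    left side is [4 n - 2 S]. *)
Lemma sum_mirror_err (eps : R) : (0 < n)%N -> 1 - eps <= accept_prob dot X Z psi ->
  \sum_j (mirror_err_x j ^+ 2 + mirror_err_z j ^+ 2) <= 8 * n%:R * eps.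
Proof.
move=> n0; have np : 0 < n%:R :> R by rewrite ltr0n.
have rX j : is_reflection dot (X j) by case: (qXZ j).
have rZ j : is_reflection dot (Z j) by case: (qXZ j).
pose cz j := correlation dot X Z (before j) j (after j) psi.
pose cx j := correlation dot Z X (before j) j (after j) psi.
have -> : accept_prob dot X Z psi =
    2^-1 * (n%:R^-1 * \sum_(j < n) 2^-1 * (1 + cz j)) +
    2^-1 * (n%:R^-1 * \sum_(j < n) 2^-1 * (1 + cx j)).
  by rewrite /accept_prob !accept_prob_orderE // -sqr_hnorm psi1 expr1n.
have -> : \sum_j (mirror_err_x j ^+ 2 + mirror_err_z j ^+ 2) =
    \sum_(j < n) (2 - 2 * cx j + (2 - 2 * cz j)).
  by apply: eq_bigr => j _; rewrite sqr_mirror_err_x sqr_mirror_err_z.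
have E : \sum_(j < n) (2 - 2 * cx j + (2 - 2 * cz j)) =
   8 * n%:R - 4 * (\sum_(j < n) 2^-1 * (1 + cz j) + \sum_(j < n) 2^-1 * (1 + cx j)).
  rewrite -big_split mulr_sumr /=.
  have -> : 8 * n%:R = \sum_(j < n) 8 :> R.
    by rewrite sumr_const card_ord mulr_natr.
  by rewrite -sumrB; apply: eq_bigr => j _; field.
rewrite E -mulrDr -mulrDr; set T := (X in 4 * X) => h.
have : n%:R * (1 - eps) <= 2^-1 * T.
  rewrite -(ler_pM2l np) in h; apply: le_trans h _.
  by rewrite mulrCA mulVKf ?gt_eqF.
lra.
Qed.

Lemma mirror_err_le (eps : R) j : (0 < n)%N -> 0 <= eps ->
  1 - eps <= accept_prob dot X Z psi ->
  mirror_err_x j <= 3 * n%:R * Num.sqrt eps /\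
  mirror_err_z j <= 3 * n%:R * Num.sqrt eps.
Proof.
move=> n0 e0 /(sum_mirror_err n0); rewrite (bigD1 j) //= => h.
have n1 : 1 <= n%:R :> R by rewrite ler1n.
have rest : 0 <= \sum_(i < n | i != j) (mirror_err_x i ^+ 2 + mirror_err_z i ^+ 2).
  by apply: sumr_ge0 => i _; rewrite addr_ge0 ?sqr_ge0.
have sx := sqr_ge0 (mirror_err_x j); have sz := sqr_ge0 (mirror_err_z j).
(* The bound [8 n <= 9 n^2] turns [sqrt (8 n eps)] into [3 n sqrt eps]. *)
have big : 8 * n%:R * eps <= (3 * n%:R * Num.sqrt eps) ^+ 2.
  by rewrite exprMn sqr_sqrtr //; nra.
have nn : 0 <= 3 * n%:R * Num.sqrt eps by rewrite !mulr_ge0 ?sqrtr_ge0.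
split; rewrite -(@ler_pXn2r _ 2) ?nnegrE ?hnorm_nneg //; apply: le_trans big; lra.
Qed.

(** The transpose of the qubit operator, moved to j'': σ^x and σ^z are symmetric and σ^y is
    antisymmetric, whence [- d]. *)
Definition mirror_op j (a b c d : C) : W -> W :=
  qubit_op (second_x V j) (second_z V j) a b c (- d).

(** Mirroring reverses products: [Xh Zh Psi = Xh z'' Psi = z'' Xh Psi = z'' x'' Psi = - x'' z''
    Psi]. *)
Lemma hat_op_mirror j a b c d :
  qubit_op (hat_x j) (hat_z j) a b c d PsiXZ = mirror_op j a b c d PsiXZ.
Proof.
have [_ xz _ zz] := hat_commuting j j; have [_ _ xzj] := second_qubit dot j.
rewrite /mirror_op /qubit_op hat_mirror_z hat_mirror_x xz hat_mirror_x.
congr (_ + _); rewrite scaleNr -scalerN -scalerN; congr (_ *: (_ *: _)).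
by apply/eqP; rewrite -addr_eq0 addrC xzj.
Qed.

(** The product term is [X Z Psi - z'' x'' Psi = X (Z Psi - z'' Psi) + z'' (X Psi - x'' Psi)]. It
    costs two errors, and the [X] and [Z] terms cost one each. *)
Lemma mirror_close j a b c d (e : R) : `|b| <= 1 -> `|c| <= 1 -> `|d| <= 1 ->
  mirror_err_x j <= e -> mirror_err_z j <= e ->
  hnorm Dot (ext (qubit_op (X j) (Z j) a b c d) PsiXZ - mirror_op j a b c d PsiXZ)
  <= 4 * e.
Proof.
move=> b1 c1 d1 ex ez; have [rX _ _] := qXZ j.
have [_ rz xzj] := second_qubit dot j.
set x := second_x V j in xzj *; set z := second_z V j in rz xzj *.
have -> : ext (qubit_op (X j) (Z j) a b c d) PsiXZ - mirror_op j a b c d PsiXZ =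
    (b *: (ext (X j) PsiXZ - x PsiXZ) + c *: (ext (Z j) PsiXZ - z PsiXZ)) +
    d *: ('i%C *: (ext (X j) (ext (Z j) PsiXZ - z PsiXZ) +
                 z (ext (X j) PsiXZ - x PsiXZ))).
  have zX : ext (X j) (z PsiXZ) = z (ext (X j) PsiXZ).
    exact: extend_sign_commuting.
  have XB u v : ext (X j) (u - v) = ext (X j) u - ext (X j) v by exact: linearB.
  rewrite XB (linearB z) zX subrKA.
  have -> : z (x PsiXZ) = - x (z PsiXZ) by apply/eqP; rewrite -addr_eq0 addrC xzj.
  rewrite extend_qubit_op /mirror_op /qubit_op -/x -/z.
  apply: (dot_ext (dot := Dot)) => h.
  by rewrite !(linearDl, linearNl, linearZl_LR) /=; ring.
have scale (u : C) f : `|u| <= 1 -> hnorm Dot (u *: f) <= hnorm Dot f.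
  move=> u1; rewrite hnormZ ler_piMl ?hnorm_nneg //.
  by move: u1; rewrite lecE => /andP[].
have i1 : `|'i%C| <= 1 :> C by rewrite normc_def /= expr0n expr1n /= add0r sqrtr1.
apply: le_trans (hnorm_triangle _ _ _) _.
rewrite (_ : 4 * e = (e + e) + (e + e)); last by ring.
apply: lerD.
  apply: le_trans (hnorm_triangle _ _ _) _.
  by apply: lerD; apply: le_trans (scale _ _ _) _.
do 2!apply: le_trans (scale _ _ _) _ => //.
apply: le_trans (hnorm_triangle _ _ _) _.
rewrite (reflection_hnorm _ rz) (reflection_hnorm _ (extend_op_reflection n rX)).
by rewrite lerD.
Qed.

End Untangling.

Theorem theorem4p3 (R : realType) :
  exists C : R, 0 < C /\
  forall (n : nat) (H : completeNormedModType R[i])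
    (dot : {dot H for @conjC R[i]}) (psi : H)
    (X Z : 'I_n -> {linear H -> H}) (eps : R),
  (0 < n)%N ->
  (forall x : H, `|x| = (hnorm dot x)%:C) ->
  hnorm dot psi = 1 ->
  (forall j, is_qubit dot (X j) (Z j)) ->
  0 <= eps ->
  1 - eps <= accept_prob dot X Z psi ->
  exists Xh Zh : 'I_n -> {linear with_registers H n -> with_registers H n},
  [/\ forall j, is_qubit (sumdot dot (T:=registers n)) (Xh j) (Zh j),
      independent_qubits Xh Zh &
      forall (k : nat) (j : 'I_k -> 'I_n) (a b c d : 'I_k -> R[i]),
      (0 < k)%N ->
      (forall l, (opnorm dot
         (qubit_op (X (j l)) (Z (j l)) (a l) (b l) (c l) (d l)) <= 1)%E) ->
      hnorm (sumdot dot (T:=registers n))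
        (op_prod (fun l => extend_op
           (qubit_op (X (j l)) (Z (j l)) (a l) (b l) (c l) (d l)))
           (Psi X Z psi)
         - op_prod (fun l =>
             qubit_op (Xh (j l)) (Zh (j l)) (a l) (b l) (c l) (d l))
           (Psi X Z psi))
      <= C * k%:R * n%:R * Num.sqrt eps].
Proof.
(* Each replaced factor costs 4 mirror errors of at most [3 n sqrt eps]. *)
exists 12; split=> // n H dot psi X Z eps n0 _ psi1 qXZ e0 acc.
exists (hat_x X Z), (hat_z X Z); split.
- exact: hat_qubit.
- exact: hat_independent.
move=> k j a b c d k0 op1.
have psi0 : psi != 0.
  apply/eqP => p0; move: psi1; rewrite p0 hnorm0 => /esym/eqP.
  by rewrite oner_eq0.
(* Operator norms pass through the 2 by 2 matrix to the extended operators and to the mirrored ones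
   on j''; the nonzero [psi] supplies an eigenvector of [Z]. *)
have contr l := opnorm_matrix_contraction (qXZ (j l)) psi0
  (fun y => opnorm_le1 y
    (qubit_opZ dot (X (j l)) (Z (j l)) (a l) (b l) (c l) (d l)) (op1 l)).
have eqn : 12 * k%:R * n%:R * Num.sqrt eps =
    (size (enum 'I_k))%:R * (4 * (3 * n%:R * Num.sqrt eps)).
  rewrite size_enum_ord; ring.
rewrite eqn.
pose D : {dot with_registers H n for @conjC R[i]} := sumdot dot (T:=registers n).
apply: (hnorm_telescope (V := fun l => mirror_op (j l) (a l) (b l) (c l) (d l))).
- by move=> l u v; rewrite !extend_qubit_op (qubit_opB D).
- by move=> l u v; rewrite /mirror_op (qubit_opB D).
- move=> l u; rewrite extend_qubit_op -dot_le_hnorm.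
  exact: (matrix_contractionP (extend_op_qubit n (qXZ (j l))) u (contr l).1).
- move=> l u; rewrite -dot_le_hnorm.
  exact: (matrix_contractionP (second_qubit dot (j l)) u (contr l).2).
- move=> l m u; rewrite !extend_qubit_op; apply: (qubit_op_commuting2 D).
  split; [exact: extend_permute_commuting|exact: extend_sign_commuting|
    exact: extend_permute_commuting|exact: extend_sign_commuting].
- move=> l m u; apply: (qubit_op_commuting2 D).
  exact: hat_commuting.
- by move=> l; exact: hat_op_mirror.
- move=> l; have [b1 c1 d1] := matrix_contraction_le1 (contr l).1.
  have [ex ez] := mirror_err_le psi1 qXZ (j l) n0 e0 acc.
  exact: mirror_close.
Qed.
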